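(* Let $P\subset\mathbb{R}^n$ be a closed convex cone that is spanning ($P-P=\mathbb{R}^n$) and pointed ($P\cap -P=\{0\}$), and let $\Omega$ be the interior of $P$. Let $M$ be a von Neumann algebra with separable predual $M_*$, and let $\alpha=\{\alpha_x : x\in\Omega\}$ be a $\sigma$-weakly measurable $E^\Omega$-semigroup on $M$. Assume that $\alpha$ is faithful, i.e. $\bigcap_{x\in\Omega}\ker(\alpha_x)=\{0\}$. (i) Then $\alpha$ is a $\sigma$-weakly continuous $E^\Omega$-semigroup on $M$. (ii) Suppose that $\alpha$ is an $E_0^\Omega$-semigroup, i.e. $\alpha_x(1)=1$ for every $x\in\Omega$. Then there exists a unique $E_0^P$-semigroup $\{\widetilde{\alpha}_x : x\in P\}$ on $M$ such that $\widetilde{\alpha}_x=\alpha_x$ for every $x\in\Omega$.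
   Context: A $\sigma$-weakly measurable (resp. $\sigma$-weakly continuous) $E^\Omega$-semigroup on $M$ is a family $\{\alpha_x\}_{x\in\Omega}$ of normal $*$-endomorphisms of $M$ (not necessarily unital) such that $\alpha_x\circ\alpha_y=\alpha_{x+y}$ for all $x,y\in\Omega$ and, for every $\rho\in M_*$ and $A\in M$, the map $\Omega\ni x\mapsto\rho(\alpha_x(A))\in\mathbb{C}$ is Borel measurable (resp. continuous). An $E_0^P$-semigroup on $M$ is a family $\{\alpha_x\}_{x\in P}$ of normal unital $*$-endomorphisms of $M$ such that $\alpha_x\circ\alpha_y=\alpha_{x+y}$ for all $x,y\in P$, $\alpha_0$ is the identity map, and for every $\rho\in M_*$ and $A\in M$ the map $P\ni x\mapsto\rho(\alpha_x(A))\in\mathbb{C}$ is continuous. *)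

(* Defs.v *)
From HB Require Import structures.
From mathcomp Require Import all_boot all_order all_algebra.
From mathcomp Require Import all_classical all_reals all_analysis.
From mathcomp Require Import complex sesquilinear.

Set Implicit Arguments.
Unset Strict Implicit.
Unset Printing Implicit Defensive.

Import Order.TTheory GRing.Theory Num.Theory.
Import numFieldNormedType.Exports.

Local Open Scope classical_set_scope.
Local Open Scope ring_scope.
Local Open Scope complex_scope.

Section Cones.
Context {R : realType} {n : nat}.
Implicit Type P : set 'rV[R]_n.

Definition closed_convex_cone P : Prop :=
  [/\ closed P,
      P 0,
      forall x y, P x -> P y -> P (x + y) &
      forall (a : R) x, 0 <= a -> P x -> P (a *: x)].

Definition spanning P : Prop :=
  forall v, exists x y, [/\ P x, P y & v = x - y].

Definition pointed P : Prop := forall x, P x -> P (- x) -> x = 0.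

End Cones.

(* The complex numbers are R[i]; their topology is carried by the copy R[i]^o. *)
Section VonNeumannAlgebras.
Context {R : realType} {H : completeNormedModType R[i]}.
Variable dot : {dot H for @conjc R}.

(* The norm of the Banach space H is the one of the inner product, which is
   linear in its first argument. *)
Definition hilbert_norm : Prop := forall x : H, `|x| ^+ 2 = dot x x.

Definition bounded_operator (A : H -> H) : Prop := linear A /\ continuous A.

Definition adjoint (A B : H -> H) : Prop :=
  forall x y : H, dot (A x) y = dot x (B y).

Definition commutant (S : set (H -> H)) : set (H -> H) :=
  [set B | bounded_operator B /\ forall A, S A -> A \o B = B \o A].

(* A commutant is a linear subspace containing the identity and stable under
   composition, so the last clause makes M a unital algebra. *)
Definition von_neumann_algebra (M : set (H -> H)) : Prop :=
  [/\ forall A, M A -> bounded_operator A,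
      forall A, M A -> exists2 B, M B & adjoint A B &
      commutant (commutant M) = M].

Definition square_summable (xi : nat -> H) : Prop :=
  cvgn (series (fun k => `|xi k| ^+ 2 : R[i]^o)).

(* The normal (sigma-weakly continuous) functionals on M, that is the
   restrictions to M of A |-> tr (T A) for T of trace class, written as
   A |-> \sum_k <A xi_k, eta_k>. Only the values on M matter: functionals that
   coincide on M represent the same element of the predual. *)
Definition predual (M : set (H -> H)) : set ((H -> H) -> R[i]^o) :=
  [set rho | exists xi eta : nat -> H,
     [/\ square_summable xi, square_summable eta &
         forall A, M A ->
           series (fun k => dot (A (xi k)) (eta k) : R[i]^o) @ \oo --> rho A]].

Definition operator_unit_ball (A : H -> H) : Prop :=
  forall x, `|A x| <= `|x|.

(* Separability for the norm of the dual of M. *)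
Definition separable_predual (M : set (H -> H)) : Prop :=
  exists D : set ((H -> H) -> R[i]^o),
    [/\ countable D, D `<=` predual M &
        forall rho, predual M rho -> forall e : R, 0 < e ->
          exists2 rho', D rho' &
            forall A, M A -> operator_unit_ball A ->
              `|rho A - rho' A| <= e%:C].

(* Only the values of f on M matter. Normality is sigma-weak continuity, which
   for a linear map means that precomposition preserves the predual. *)
Definition normal_star_endomorphism (M : set (H -> H))
    (f : (H -> H) -> (H -> H)) : Prop :=
  [/\ forall A, M A -> M (f A),
      forall (a : R[i]) A B, M A -> M B -> f (a *: A + B) = a *: f A + f B,
      forall A B, M A -> M B -> f (A \o B) = f A \o f B,
      forall A B, M A -> M B -> adjoint A B -> adjoint (f A) (f B) &
      forall rho, predual M rho -> predual M (rho \o f)].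

End VonNeumannAlgebras.

(* A family indexed by S is a function on R^n, of which only the values on S
   (and, for each of these, on M) matter. *)
Section Semigroups.
Context {R : realType} {n : nat} {H : completeNormedModType R[i]}.
Variables (dot : {dot H for @conjc R}) (M : set (H -> H)) (S : set 'rV[R]_n).
Implicit Type alpha : 'rV[R]_n -> (H -> H) -> (H -> H).

Definition E_semigroup alpha : Prop :=
  (forall x, S x -> normal_star_endomorphism dot M (alpha x)) /\
  (forall x y A, S x -> S y -> M A ->
     alpha x (alpha y A) = alpha (x + y) A).

Let borel_rV := g_sigma_algebraType (@open 'rV[R]_n).
Let borel_C := g_sigma_algebraType (@open R[i]^o).

Definition sigma_weakly_measurable alpha : Prop :=
  forall rho A, predual dot M rho -> M A ->
    measurable_fun (S : set borel_rV)
      ((fun x => rho (alpha x A)) : borel_rV -> borel_C).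

Definition sigma_weakly_continuous alpha : Prop :=
  forall rho A, predual dot M rho -> M A ->
    {within S, continuous (fun x => rho (alpha x A))}.

Definition faithful alpha : Prop :=
  forall A, M A -> (forall x, S x -> alpha x A = 0) -> A = 0.

Definition unital alpha : Prop := forall x, S x -> alpha x idfun = idfun.

Definition E0_semigroup alpha : Prop :=
  [/\ E_semigroup alpha,
      unital alpha,
      forall A, M A -> alpha 0 A = A &
      sigma_weakly_continuous alpha].

Definition same_family alpha beta : Prop :=
  forall x A, S x -> M A -> alpha x A = beta x A.

End Semigroups.

(* Main.v *)
(* alpha_x acts on the predual by contractions T_x.  Since the predual is
   separable, x |-> T_x rho is a norm Borel map, hence has the Baire property,
   and Pettis' difference argument together with the semigroup law makes it norm
   continuous on the interior of P; this is (i).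
   For (ii), Hahn-Banach turns faithfulness into norm density of the span of the
   T_y rho, y interior.  On that span T_{z+x} rho converges as x -> 0 in the
   interior, for every z in P.  So alpha_{z+x}(A) converges weakly to some B in
   M, and B is the only element of M with alpha_y(B) = alpha_{y+z}(A) for all
   interior y.  This characterisation of alpha'_z(A) gives all the algebraic
   properties and uniqueness; density gives continuity on P and normality of
   alpha'_z, the predual being closed in the dual of M. *)
Require Import Defs.
From HB Require Import structures.
From mathcomp Require Import all_boot all_order all_algebra.
From mathcomp Require Import all_classical all_reals all_analysis.
From mathcomp Require Import complex sesquilinear.
From mathcomp Require Import ring lra.

Set Implicit Arguments.
Unset Strict Implicit.
Unset Printing Implicit Defensive.

Import Order.TTheory GRing.Theory Num.Theory.
Import numFieldNormedType.Exports.

Local Open Scope classical_set_scope.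
Local Open Scope ring_scope.
Local Open Scope complex_scope.

(** The predual is only a set of functionals here, so its duality with [M] has to be rebuilt. One
    device does this, [sublinear_attained]: Hahn-Banach on finite real functionals, Riesz
    representation of the resulting form, then the bicommutant condition. It is used with two
    sublinear functionals. The least mass of a representation leads to norm closedness of the
    predual; the distance to the orbit functionals leads to their density. Contractivity is not part
    of the definition of a normal endomorphism. It is derived from multiplicativity and normality,
    and it is what transports estimates on the unit ball through [alpha x]. In (i), category takes
    the place of measure: a Borel set agrees with an open set on a comeager set, and a comeager set
    and its translates meet inside every nonempty open set. In (ii), a boundary point z is reached
    only through y + z, which is interior as soon as y is. *)

Local Notation Re := complex.Re.
Local Notation Im := complex.Im.

(** * The Hahn-Banach theorem for sublinear functionals *)

Section HahnBanach.
Context {R : realType} {V : lmodType R}.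
Variable F : set V.
Hypothesis FD : forall x y, F x -> F y -> F (x + y).
Hypothesis FZ : forall (t : R) x, F x -> F (t *: x).

(** Everything is relative to a subspace [F], because the application is to the finite functionals
    inside the space of all functions on operators. *)
Definition sublinear_on (p : V -> R) :=
  (forall x y, F x -> F y -> p (x + y) <= p x + p y) /\
  (forall (t : R) x, 0 <= t -> F x -> p (t *: x) = t * p x).

Lemma sublinear_on0 p x : F x -> sublinear_on p -> p 0 = 0.
Proof. by move=> Fx [_ pZ]; rewrite -(scale0r x) pZ// mul0r. Qed.

Lemma sublinear_onN p x : F x -> sublinear_on p -> - p (- x) <= p x.
Proof.
move=> Fx pS; have FNx : F (- x) by rewrite -scaleN1r; exact: FZ.
have := pS.1 _ _ Fx FNx; rewrite subrr (sublinear_on0 Fx pS).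
by rewrite -lerBlDr sub0r.
Qed.

(** The inequality at [t^-1] and [t *: x] is the converse of the one at [t] and [x], so an infimum
    only has to be bounded in one direction. *)
Lemma sublinear_onI p : (forall x y, F x -> F y -> p (x + y) <= p x + p y) ->
  (F !=set0 -> p 0 = 0) ->
  (forall (t : R) x, 0 < t -> F x -> p (t *: x) <= t * p x) -> sublinear_on p.
Proof.
move=> pD p0 pZ; split=> // t x; rewrite le_eqVlt => /predU1P[<- Fx|t0 Fx].
  by rewrite scale0r mul0r p0//; exists x.
apply/eqP; rewrite eq_le pZ//=.
have := pZ t^-1 _ (_ : 0 < t^-1) (FZ t Fx).
rewrite invr_gt0 scalerA mulVf ?gt_eqF// scale1r => /(_ t0).
by rewrite ler_pdivlMl.
Qed.

(* The tangent of p in direction y; it is linear along y. *)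
Definition sublinear_tangent (p : V -> R) y x :=
  inf [set p (x + t *: y) - t * p y | t in [set t | 0 <= t]].

Section Tangent.
Variables (p : V -> R) (y : V).
Hypotheses (pS : sublinear_on p) (Fy : F y).

Let lb x : F x -> lbound [set p (x + t *: y) - t * p y | t in [set t | 0 <= t]]
  (- p (- x)).
Proof.
move=> Fx _ [t /= t0 <-]; rewrite lerBrDr addrC lerBlDr -pS.2//.
have FNx : F (- x) by rewrite -scaleN1r; exact: FZ.
have := pS.1 _ _ (FD Fx (FZ t Fy)) FNx.
by rewrite addrAC subrr add0r.
Qed.

Lemma sublinear_tangent_le t x : F x -> 0 <= t ->
  sublinear_tangent p y x <= p (x + t *: y) - t * p y.
Proof.
by move=> Fx t0; apply: ge_inf; [exists (- p (- x)); exact: lb|exists t].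
Qed.

Lemma sublinear_tangent_ge m x :
  (forall t, 0 <= t -> m <= p (x + t *: y) - t * p y) ->
  m <= sublinear_tangent p y x.
Proof.
move=> mp; apply: lb_le_inf; first by exists (p (x + 0 *: y) - 0 * p y), 0 => /=.
by move=> _ [t /= t0 <-]; exact: mp.
Qed.

Lemma sublinear_tangentS : sublinear_on (sublinear_tangent p y).
Proof.
apply: sublinear_onI => [x z Fx Fz|_|s x s0 Fx].
- rewrite -lerBlDr; apply: sublinear_tangent_ge => t t0.
  rewrite lerBlDr [leRHS]addrC -lerBlDr; apply: sublinear_tangent_ge => s s0.
  rewrite lerBlDr; apply: le_trans (sublinear_tangent_le (FD Fx Fz) (addr_ge0 s0 t0)) _.
  rewrite mulrDl opprD addrACA lerD2r scalerDl.
  rewrite [x + z]addrC addrACA.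
  by apply: pS.1; apply: FD => //; exact: FZ.
- have F0 : F 0 by rewrite -(scale0r y); exact: FZ.
  apply/eqP; rewrite eq_le; apply/andP; split.
    apply: le_trans (sublinear_tangent_le F0 (lexx 0)) _.
    by rewrite scale0r addr0 (sublinear_on0 Fy pS) mul0r subrr.
  by apply: sublinear_tangent_ge => t t0; rewrite add0r pS.2// subrr.
- rewrite -ler_pdivrMl//; apply: sublinear_tangent_ge => t t0.
  rewrite ler_pdivrMl//.
  have st0 : 0 <= s * t by rewrite mulr_ge0// ltW.
  apply: le_trans (sublinear_tangent_le (FZ s Fx) st0) _.
  rewrite -scalerA -scalerDr pS.2 ?(ltW s0)//; last exact/FD/FZ.
  by rewrite mulrBr mulrA.
Qed.

Lemma sublinear_tangent_id x : F x -> sublinear_tangent p y x <= p x.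
Proof.
move=> Fx; apply: le_trans (sublinear_tangent_le Fx (lexx 0)) _.
by rewrite scale0r mul0r subr0 addr0.
Qed.

End Tangent.

Lemma minimal_sublinear (p : V -> R) : sublinear_on p ->
  exists q, [/\ sublinear_on q, forall x, F x -> q x <= p x &
    forall r, sublinear_on r -> (forall x, F x -> r x <= q x) ->
      forall x, F x -> q x <= r x].
Proof.
move=> pS.
pose T := {q : V -> R | sublinear_on q /\ forall x, F x -> q x <= p x}.
(* The order is reversed: the maximal element given by Zorn's lemma is a minimal functional. A chain
   is bounded by its pointwise infimum, finite because every member is at least [- p (- x)]. *)
pose le (a b : T) := `[< forall x, F x -> sval b x <= sval a x >].
have t0 : T by exists p.
have [||A Atot|q qmin] := @ZL_preorder T t0 le.
- by move=> t; apply/asboolP.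
- move=> r s t /asboolP sr /asboolP rt; apply/asboolP => x Fx.
  exact: le_trans (rt x Fx) (sr x Fx).
- have [[a Aa]|A0] := pselect (A !=set0); last first.
    by exists t0 => s As; exfalso; apply: A0; exists s.
  pose q x := inf [set sval s x | s in A].
  have lb x : F x -> has_lbound [set sval s x | s in A].
    move=> Fx; exists (- p (- x)) => _ [s As <-].
    have [sS sp] := svalP s.
    apply: le_trans (sublinear_onN Fx sS); rewrite lerN2.
    by apply: sp; rewrite -scaleN1r; exact: FZ.
  have qle s x : A s -> F x -> q x <= sval s x.
    by move=> As Fx; apply: ge_inf; [exact: lb|exists s].
  have qge m x : (forall s, A s -> m <= sval s x) -> m <= q x.
    by move=> h; apply: lb_le_inf; [exists (sval a x), a|move=> _ [s As <-]; exact: h].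
  have qS : sublinear_on q.
    apply: sublinear_onI => [x z Fx Fz|[x0 Fx0]|s x s0 Fx].
    + rewrite -lerBlDr; apply: (qge _ _) => s As.
      rewrite lerBlDr [leRHS]addrC -lerBlDr; apply: qge => t At; rewrite lerBlDr.
      have Fxz := FD Fx Fz.
      have [sS _] := svalP s; have [tS _] := svalP t.
      have [/asboolP st|/asboolP ts] := Atot _ _ As At.
        apply: le_trans (qle _ _ At Fxz) _; rewrite [leRHS]addrC.
        by apply: le_trans (tS.1 _ _ Fx Fz) _; rewrite lerD// st.
      apply: le_trans (qle _ _ As Fxz) _; rewrite [leRHS]addrC.
      by apply: le_trans (sS.1 _ _ Fx Fz) _; rewrite lerD// ts.
    + have F0 : F 0 by rewrite -(scale0r x0); exact: FZ.
      apply/eqP; rewrite eq_le; apply/andP; split.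
        by rewrite -(sublinear_on0 Fx0 (svalP a).1); exact: qle.
      by apply: qge => s As; rewrite (sublinear_on0 Fx0 (svalP s).1).
    + rewrite -ler_pdivrMl//; apply: qge => t At; rewrite ler_pdivrMl//.
      apply: le_trans (qle _ _ At (FZ s Fx)) _.
      by rewrite (svalP t).1.2 ?(ltW s0).
  have qp x : F x -> q x <= p x.
    by move=> Fx; apply: le_trans (qle _ _ Aa Fx) _; exact: (svalP a).2.
  exists (exist _ q (conj qS qp)) => s As; apply/asboolP => x Fx; exact: qle.
exists (sval q); have [qS qp] := svalP q; split => // r rS rq x Fx.
have rp z : F z -> r z <= p z by move=> Fz; exact: le_trans (rq z Fz) (qp z Fz).
have /asboolP := qmin (exist _ r (conj rS rp)) (asboolT rq); exact.
Qed.

(** Take a minimal [q] below the tangent of [p] at [v]. The tangents of [q] are sublinear and below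
    [q], so by minimality they equal [q]; at t = 1 this is superadditivity. Starting from the
    tangent at [v] rather than from [p] forces [q (- v) <= - p v], hence equality at [v]. *)
Theorem hahn_banach (p : V -> R) (v : V) : sublinear_on p -> F v ->
  exists f : V -> R,
    [/\ forall x y, F x -> F y -> f (x + y) = f x + f y,
        forall (t : R) x, F x -> f (t *: x) = t * f x,
        forall x, F x -> f x <= p x & f v = p v].
Proof.
move=> pS Fv.
have [q [qS qpv qmin]] := minimal_sublinear (sublinear_tangentS pS Fv).
have qp x : F x -> q x <= p x.
  by move=> Fx; apply: le_trans (qpv x Fx) _; exact: sublinear_tangent_id.
have qD x y : F x -> F y -> q (x + y) = q x + q y.
  move=> Fx Fy; apply/eqP; rewrite eq_le qS.1//=.
  have := qmin _ (sublinear_tangentS qS Fy) (sublinear_tangent_id qS Fy) x Fx.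
  move=> /le_trans/(_ (sublinear_tangent_le qS Fy Fx ler01)).
  by rewrite scale1r mul1r lerBrDr.
have FN x : F x -> F (- x) by move=> Fx; rewrite -scaleN1r; exact: FZ.
have qN x : F x -> q (- x) = - q x.
  move=> Fx; apply/eqP; rewrite -subr_eq0 opprK -qD//; last exact: FN.
  by rewrite addNr (sublinear_on0 Fx qS).
exists q; split => // [t x Fx|].
  have [t0|t0] := leP 0 t; first exact: qS.2.
  rewrite -[t]opprK scaleNr qN; last exact: FZ.
  by rewrite qS.2 ?mulNr// oppr_ge0 ltW.
apply/eqP; rewrite eq_le qp//=.
have := le_trans (qpv _ (FN _ Fv)) (sublinear_tangent_le pS Fv (FN _ Fv) ler01).
rewrite scale1r addNr mul1r (sublinear_on0 Fv pS) sub0r qN//.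
by rewrite lerN2.
Qed.

End HahnBanach.

(** * Real inner product, Riesz representation and bounded forms *)

Section InnerProduct.
Context {R : realType} {H : completeNormedModType R[i]}.
Variable dot : {dot H for @conjc R}.

Definition rdot x y : R := Re (dot x y).
Definition rnorm (x : H) : R := Re `|x|.

Lemma ReD (a b : R[i]) : Re (a + b) = Re a + Re b. Proof. by case: a; case: b. Qed.
Lemma ReN (a : R[i]) : Re (- a) = - Re a. Proof. by case: a. Qed.
Lemma ReZ (t : R) (a : R[i]) : Re (t%:C * a) = t * Re a.
Proof. by case: a => x y /=; rewrite mul0r subr0. Qed.

Lemma rdotDl x y z : rdot (x + y) z = rdot x z + rdot y z.
Proof. by rewrite /rdot linearDl ReD. Qed.
Lemma rdotDr x y z : rdot x (y + z) = rdot x y + rdot x z.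
Proof. by rewrite /rdot linearDr ReD. Qed.
Lemma rdotNl x y : rdot (- x) y = - rdot x y.
Proof. by rewrite /rdot linearNl ReN. Qed.
Lemma rdotNr x y : rdot x (- y) = - rdot x y.
Proof. by rewrite /rdot linearNr ReN. Qed.
Lemma rdotBl x y z : rdot (x - y) z = rdot x z - rdot y z.
Proof. by rewrite rdotDl rdotNl. Qed.
Lemma rdotBr x y z : rdot x (y - z) = rdot x y - rdot x z.
Proof. by rewrite rdotDr rdotNr. Qed.
Lemma dotZl a x y : dot (a *: x) y = a * dot x y.
Proof. exact: linearZl_LR. Qed.
Lemma dotZr a x y : dot x (a *: y) = conjc a * dot x y.
Proof. exact: linearZr_LR. Qed.
Lemma rdotZl (t : R) x y : rdot (t%:C *: x) y = t * rdot x y.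
Proof. by rewrite /rdot dotZl ReZ. Qed.
Lemma rdotZr (t : R) x y : rdot x (t%:C *: y) = t * rdot x y.
Proof. by rewrite /rdot dotZr conjc_real ReZ. Qed.
Lemma dotC x y : dot x y = conjc (dot y x).
Proof. by rewrite hermC expr0 mul1r. Qed.
Lemma rdotC x y : rdot x y = rdot y x.
Proof. by rewrite /rdot dotC; case: (dot y x). Qed.
Lemma rdot0l y : rdot 0 y = 0. Proof. by rewrite /rdot linear0l. Qed.
Lemma rdot0r y : rdot y 0 = 0. Proof. by rewrite /rdot linear0r. Qed.

Lemma Im_dot x y : Im (dot x y) = rdot x ('i *: y).
Proof. by rewrite /rdot dotZr; case: (dot x y) => a b /=; rewrite mul0r sub0r mulN1r opprK. Qed.

Lemma rdot_il x y : rdot ('i *: x) y = - rdot x ('i *: y).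
Proof.
rewrite /rdot dotZl dotZr; case: (dot x y) => a b /=.
by rewrite !mul0r !sub0r mulN1r !opprK mul1r.
Qed.

Lemma dotE x y : dot x y = rdot x y +i* rdot x ('i *: y).
Proof. by rewrite -Im_dot /rdot; case: (dot x y). Qed.

Lemma rdot_inj x y : (forall z, rdot x z = rdot y z) -> x = y.
Proof.
move=> xy; apply/eqP; rewrite -subr_eq0; apply/negPn/negP => /(@neq0_dnorm_gt0 _ _ _ dot).
by rewrite dotE !rdotBl !xy !subrr ltxx.
Qed.

Lemma rnormE x : `|x| = (rnorm x)%:C.
Proof. by rewrite /rnorm RRe_real// normr_real. Qed.

Lemma rnorm_ge0 x : 0 <= rnorm x.
Proof. by rewrite -ler0c -rnormE. Qed.

Lemma ler_rnormD x y : rnorm (x + y) <= rnorm x + rnorm y.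
Proof. by rewrite -lecR rmorphD/= -!rnormE ler_normD. Qed.

Lemma rnormN x : rnorm (- x) = rnorm x.
Proof. by rewrite /rnorm normrN. Qed.

Lemma rnormB x y : rnorm (x - y) = rnorm (y - x).
Proof. by rewrite -opprB rnormN. Qed.

Lemma rnorm0 : rnorm 0 = 0. Proof. by rewrite /rnorm normr0. Qed.

Lemma normc_real (t : R) : `|t%:C| = `|t|%:C.
Proof. by rewrite normc_def/= expr0n addr0 sqrtr_sqr. Qed.

Lemma rnormZ (t : R) x : rnorm (t%:C *: x) = `|t| * rnorm x.
Proof. by rewrite /rnorm normrZ normc_real ReZ. Qed.

Lemma rnorm_unit_ball (A : H -> H) :
  operator_unit_ball A <-> forall x, rnorm (A x) <= rnorm x.
Proof. by split=> h x; have := h x; rewrite !rnormE lecR. Qed.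

Hypothesis Hhilbert : hilbert_norm dot.

Lemma rnorm_sqr x : rnorm x ^+ 2 = rdot x x.
Proof. by rewrite /rdot -Hhilbert rnormE -rmorphXn. Qed.

Lemma normr_le_sqr (a b : R) : 0 <= b -> a ^+ 2 <= b ^+ 2 -> `|a| <= b.
Proof.
by move=> b0; rewrite -(real_normK (num_real a)) ler_sqr ?nnegrE.
Qed.

Lemma cauchy_schwarz x y : `|rdot x y| <= rnorm x * rnorm y.
Proof.
have xy2 : rdot x y ^+ 2 <= (rnorm x * rnorm y) ^+ 2.
  have [y0|yN0] := eqVneq (rdot y y) 0.
    have rny : rnorm y = 0 by apply/eqP; rewrite -sqrf_eq0 rnorm_sqr y0.
    have -> : y = 0 by apply/eqP; rewrite -normr_eq0 rnormE rny.
    by rewrite rdot0r expr0n/= sqr_ge0.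
  have yp : 0 < rdot y y by rewrite lt_def yN0 -rnorm_sqr sqr_ge0.
  have := sqr_ge0 (rnorm (x - (rdot x y / rdot y y)%:C *: y)).
  rewrite rnorm_sqr rdotBl !rdotBr !rdotZl !rdotZr (rdotC y x) exprMn !rnorm_sqr.
  set a := rdot x y; set b := rdot y y; set c := rdot x x => h.
  suff : 0 <= (c - a / b * a) * b by rewrite mulrBl mulrAC divfK// subr_ge0.
  rewrite mulr_ge0// ?(ltW yp)//; apply: le_trans h _.
  by rewrite divfK// subrr subr0.
by rewrite -ler_sqr ?nnegrE ?mulr_ge0 ?rnorm_ge0// real_normK ?num_real.
Qed.

Lemma rdot_le x y : rdot x y <= rnorm x * rnorm y.
Proof. exact: le_trans (ler_norm _) (cauchy_schwarz x y). Qed.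

Lemma rnorm_complete (u : nat -> H) :
  (forall e : R, 0 < e -> exists N, forall m n, (N <= m)%N -> (N <= n)%N ->
     rnorm (u m - u n) < e) ->
  exists l, forall e : R, 0 < e -> exists N, forall n, (N <= n)%N ->
     rnorm (u n - l) < e.
Proof.
move=> uC; have cu : cvg (u @ \oo).
  apply: cauchy_cvg; apply: cauchy_exP => e; rewrite ltcE/= => /andP[/eqP e0 ep].
  have [N uN] := uC _ ep; exists (u N); exists N => // n /= Nn.
  rewrite -ball_normE/= rnormE ltcE/= -e0 eqxx/=; exact: uN.
exists (lim (u @ \oo)) => e e0.
have e0' : 0 < e%:C by rewrite ltcR.
have /cvgrPdist_lt/(_ _ e0')[N _ uN] := cu.
by exists N => n Nn; have := uN n Nn; rewrite /= rnormE ltcR rnormB.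
Qed.

(** Test the minimiser t = -d/q. When q = 0 the function of t is linear and bounded below, so its
    slope vanishes; t = -(e+1)/d would violate the bound. *)
Lemma quadratic_discriminant (q d e : R) : 0 <= q -> 0 <= e ->
  (forall t, - e <= 2 * t * d + t ^+ 2 * q) -> d ^+ 2 <= e * q.
Proof.
move=> q0 e0 h; have [qe|qN0] := eqVneq q 0; last first.
  have qp : 0 < q by rewrite lt_def qN0.
  have := h (- d / q).
  rewrite -(ler_pM2r qp) => {}h.
  have := h; rewrite [leRHS](_ : _ = - d ^+ 2); last by field.
  by rewrite mulNr lerN2.
rewrite qe mulr0; have [->|dN0] := eqVneq d 0; first by rewrite expr0n.
have := h (- (e + 1) / d); rewrite qe mulr0 addr0 mulrA.
rewrite [leRHS](_ : _ = - (2 * (e + 1))); last by field.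
by rewrite lerN2; lra.
Qed.

(** The representing vector minimises [J]. Near-minimality of [u n] along each line u n + t y bounds
    the defect [rdot (u n) y - f y] by the discriminant, so it vanishes in the limit. *)
Theorem riesz_representation (f : H -> R) (C : R) :
  (forall x y, f (x + y) = f x + f y) -> (forall (t : R) x, f (t%:C *: x) = t * f x) ->
  (forall x, `|f x| <= C * rnorm x) -> exists u, forall x, f x = rdot u x.
Proof.
move=> fD fZ fC.
pose J x := rdot x x - 2 * f x.
have Jlb : lbound (range J) (- C ^+ 2).
  move=> _ [x _ <-]; rewrite /J -rnorm_sqr.
  have := fC x; rewrite ler_norml => /andP[_ h].
  have := sqr_ge0 (rnorm x - C); nra.
have infJ x : inf (range J) <= J x by apply: ge_inf; [exists (- C ^+ 2)|exists x].
have /choice[u Ju] : forall n : nat, exists x, J x < inf (range J) + n.+1%:R^-1.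
  move=> n; have [||_ [x _ <-] Jx] := @inf_adherent _ (range J) n.+1%:R^-1.
  - by rewrite invr_gt0.
  - by split; [exists (J 0), 0|exists (- C ^+ 2)].
  - by exists x.
have JD x y t : J (x + t%:C *: y) = J x + (2 * t * (rdot x y - f y) + t ^+ 2 * rdot y y).
  by rewrite /J fD fZ rdotDl !rdotDr !rdotZl !rdotZr (rdotC y x); ring.
have approx n y : (rdot (u n) y - f y) ^+ 2 <= n.+1%:R^-1 * rdot y y.
  apply: quadratic_discriminant => [||t]; rewrite -?rnorm_sqr ?sqr_ge0 ?invr_ge0//.
  rewrite rnorm_sqr -(lerD2l (J (u n))) -JD.
  have h1 := infJ (u n + t%:C *: y); have h2 := Ju n.
  by rewrite lerBlDr; apply: ltW; apply: lt_le_trans h2 _; rewrite lerD2r.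
have inv_le e : 0 < e -> exists N : nat, forall n, (N <= n)%N -> n.+1%:R^-1 < e :> R.
  move=> e0; have [N _ Ne] := near_infty_natSinv_lt (PosNum e0).
  by exists N => n Nn; exact: (Ne n Nn).
have [|l ul] := rnorm_complete (u := u).
  (* Comparing [J] at [u m], [u n] and their midpoint bounds the squared distance by twice the sum
     of the two errors 1/(m+1) and 1/(n+1). *)
  move=> e e0; have e4 : 0 < e ^+ 2 / 4 by rewrite divr_gt0// exprn_gt0.
  have [N Ne] := inv_le _ e4; exists N => m n Nm Nn.
  rewrite -ltr_sqr ?nnegrE ?rnorm_ge0 ?ltW// rnorm_sqr.
  have := infJ (u m + 2^-1%:C *: (u n - u m)).
  have : J (u n) = J (u m) + (2 * 1 * (rdot (u m) (u n - u m) - f (u n - u m)) +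
      1 ^+ 2 * rdot (u n - u m) (u n - u m)).
    by rewrite -JD rmorph1 scale1r addrC subrK.
  rewrite JD.
  have := Ju m; have := Ju n; have := Ne _ Nm; have := Ne _ Nn.
  have -> : rdot (u n - u m) (u n - u m) = rdot (u m - u n) (u m - u n).
    by rewrite -opprB rdotNl rdotNr opprK.
  set a := (n.+1%:R^-1 : R); set b := (m.+1%:R^-1 : R).
  set d := rdot (u m) _ - f _; lra.
exists l => y; apply/eqP; rewrite -subr_eq0; apply/negPn/negP => dN0.
set d := f y - rdot l y in dN0.
have dp : 0 < `|d| by rewrite normr_gt0.
have yp : 0 < rnorm y + 1 by rewrite ltr_wpDl ?rnorm_ge0.
pose e : R := `|d| / 2 / (rnorm y + 1).
have e0 : 0 < e by rewrite divr_gt0// divr_gt0.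
have [N1 uN1] := ul _ e0; have [N2 uN2] := inv_le _ (exprn_gt0 2 e0).
pose n := maxn N1 N2.
have h1 := uN1 n (leq_maxl _ _); have h2 := uN2 n (leq_maxr _ _).
have h3 : `|rdot (u n) y - f y| <= e * rnorm y.
  apply: normr_le_sqr; first by rewrite mulr_ge0 ?rnorm_ge0 ?(ltW e0).
  apply: le_trans (approx n y) _; rewrite exprMn rnorm_sqr ler_wpM2r//.
    by rewrite -rnorm_sqr sqr_ge0.
  exact: ltW h2.
have h4 : `|rdot (u n) y - rdot l y| <= e * rnorm y.
  rewrite -rdotBl; apply: le_trans (cauchy_schwarz _ _) _.
  by rewrite ler_wpM2r ?rnorm_ge0 ?(ltW h1).
have : `|d| <= 2 * (e * rnorm y).
  have -> : d = (rdot (u n) y - rdot l y) - (rdot (u n) y - f y) by rewrite /d; ring.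
  by apply: le_trans (ler_normB _ _) _; lra.
have -> : 2 * (e * rnorm y) = `|d| * (rnorm y / (rnorm y + 1)).
  by rewrite /e; field; rewrite gt_eqF.
rewrite -{1}[`|d|]mulr1 ler_pM2l// ler_pdivlMr// mul1r; lra.
Qed.

Lemma bounded_operatorP (A : H -> H) : bounded_operator A <->
  linear A /\ exists2 C : R, 0 <= C & forall x, rnorm (A x) <= C * rnorm x.
Proof.
split=> [[Al Ac]|[Al [C C0 AC]]]; split=> //.
- pose f : {linear H -> H} := HB.pack A (GRing.isLinear.Build _ _ _ _ _ Al).
  have /linear_boundedP : bounded_near f (nbhs 0) by apply/linear_bounded_continuous.
  move=> [M [Mr hM]].
  have kM : M < `|M| + 1 by rewrite (le_lt_trans (real_ler_norm Mr))// ltrDl.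
  have kE : `|M| + 1 = (Re `|M| + 1)%:C.
    rewrite -[X in X + 1 = _](RRe_real (normr_real M)).
    by apply/eqP; rewrite eq_complex/= addr0 !eqxx.
  exists (Re `|M| + 1).
    by rewrite -ler0c -kE addr_ge0.
  by move=> x; have := hM _ kM x; rewrite !rnormE kE -rmorphM/= lecR.
- pose f : {linear H -> H} := HB.pack A (GRing.isLinear.Build _ _ _ _ _ Al).
  suff : continuous f by [].
  apply/linear_bounded_continuous/linear_boundedP; exists C%:C; split.
    by rewrite realE ler0c C0.
  move=> k Ck x; change (`|A x| <= k * `|x|).
  rewrite rnormE; apply: le_trans (_ : (C * rnorm x)%:C <= _); first by rewrite lecR.
  by rewrite rmorphM/= rnormE ler_wpM2r ?ler0c ?rnorm_ge0// ltW.
Qed.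

(** The rule for ['i] is what remains of sesquilinearity in the real part of a form; it makes the
    real-linear operator given by Riesz complex linear. *)
Lemma bilinear_operator (b : H -> H -> R) (C : R) :
  (forall x y z, b (x + y) z = b x z + b y z) ->
  (forall x y z, b x (y + z) = b x y + b x z) ->
  (forall (t : R) x y, b (t%:C *: x) y = t * b x y) ->
  (forall (t : R) x y, b x (t%:C *: y) = t * b x y) ->
  (forall x y, b ('i *: x) y = - b x ('i *: y)) ->
  (forall x y, `|b x y| <= C * rnorm x * rnorm y) ->
  exists A : H -> H, [/\ linear A, forall x y, b x y = rdot (A x) y &
    forall x, rnorm (A x) <= C * rnorm x].
Proof.
move=> bDl bDr bZl bZr bi bC.
have /choice[A bA] : forall x, exists u, forall y, b x y = rdot u y.
  by move=> x; apply: riesz_representation => [y z|t y|y]; [exact: bDr|exact: bZr|exact: bC].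
have AD x y : A (x + y) = A x + A y.
  by apply: rdot_inj => z; rewrite rdotDl -!bA.
have AZ (t : R) x : A (t%:C *: x) = t%:C *: A x.
  by apply: rdot_inj => z; rewrite rdotZl -!bA.
have Ai x : A ('i *: x) = 'i *: A x.
  by apply: rdot_inj => z; rewrite rdot_il -!bA.
exists A; split=> // [a x y|x].
  by rewrite AD [a]complexE !scalerDl -!scalerA AD AZ Ai AZ.
have [->|AN0] := eqVneq (rnorm (A x)) 0.
  have := bC x x; have := rnorm_ge0 x; rewrite le_eqVlt => /predU1P[<-|x0].
    by rewrite !mulr0.
  by move=> /(le_trans (normr_ge0 _)); rewrite (pmulr_lge0 _ x0).
have Ap : 0 < rnorm (A x) by rewrite lt_def AN0 rnorm_ge0.
rewrite -(ler_pM2r Ap) -expr2 rnorm_sqr -bA.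
exact: le_trans (ler_norm _) (bC _ _).
Qed.

Lemma adjoint_rdot (A B : H -> H) : linear A -> linear B ->
  (forall x y, rdot (A x) y = rdot x (B y)) -> adjoint dot A B.
Proof.
move=> Al Bl AB x y; rewrite !dotE !AB.
have -> // : B ('i *: y) = 'i *: B y.
pose f : {linear H -> H} := HB.pack B (GRing.isLinear.Build _ _ _ _ _ Bl).
exact: (linearZ_LR f).
Qed.

Lemma bounded_adjoint (A : H -> H) : bounded_operator A ->
  exists2 B, bounded_operator B & adjoint dot A B.
Proof.
move=> /bounded_operatorP[Al [C C0 AC]].
pose f : {linear H -> H} := HB.pack A (GRing.isLinear.Build _ _ _ _ _ Al).
have AD x y : A (x + y) = A x + A y by exact: (linearD f).
have AZ a x : A (a *: x) = a *: A x by exact: (linearZ_LR f).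
have [|||||x y|B [Bl bB BC]] := @bilinear_operator (fun y x => rdot (A x) y) C.
- by move=> x y z; rewrite rdotDr.
- by move=> x y z; rewrite AD rdotDl.
- by move=> t x y; rewrite rdotZr.
- by move=> t x y; rewrite AZ rdotZl.
- by move=> x y; rewrite AZ rdot_il opprK.
- apply: le_trans (cauchy_schwarz _ _) _.
  by rewrite mulrAC ler_wpM2r ?rnorm_ge0.
exists B; first by apply/bounded_operatorP; split => //; exists C.
by apply: adjoint_rdot => // x y; rewrite bB rdotC.
Qed.

End InnerProduct.

(** * Finite real functionals on operators *)

Section Functionals.
Context {R : realType} {H : completeNormedModType R[i]}.
Variable dot : {dot H for @conjc R}.
Local Notation rdot := (rdot dot).

(* Real functionals suffice: a complex-linear functional is determined by its
   real part. *)
Definition flist (l : seq (H * H)) : (H -> H) -> R^o :=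
  fun A => \sum_(p <- l) rdot (A p.1) p.2.

(** This bounds the norm of [flist l], and it depends on the representation; its infimum over
    representations is the projective norm. *)
Definition mass (l : seq (H * H)) : R := \sum_(p <- l) rnorm p.1 * rnorm p.2.

Definition scale_list (t : R) (l : seq (H * H)) : seq (H * H) :=
  [seq (p.1, t%:C *: p.2) | p <- l].

Lemma flist_cat l l' : flist (l ++ l') = flist l + flist l'.
Proof. by apply/funext => A; rewrite /flist big_cat. Qed.

Lemma flist_scale t l : flist (scale_list t l) = t *: flist l.
Proof.
apply/funext => A; rewrite /flist /scale_list big_map [RHS]mulr_sumr.
by apply: eq_bigr => p _; rewrite rdotZr.
Qed.

Lemma flist1 x y A : flist [:: (x, y)] A = rdot (A x) y.
Proof. by rewrite /flist big_seq1. Qed.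

Lemma flist_cons p l : flist (p :: l) = flist [:: p] + flist l.
Proof. by rewrite -flist_cat. Qed.

Lemma mass_cat l l' : mass (l ++ l') = mass l + mass l'.
Proof. by rewrite /mass big_cat. Qed.

Lemma mass_scale t l : mass (scale_list t l) = `|t| * mass l.
Proof.
rewrite /mass /scale_list big_map mulr_sumr.
by apply: eq_bigr => p _; rewrite rnormZ mulrCA.
Qed.

Lemma mass_ge0 l : 0 <= mass l.
Proof. by apply: sumr_ge0 => p _; rewrite mulr_ge0 ?rnorm_ge0. Qed.

Lemma rdot_adjoint (A B : H -> H) x y : adjoint dot A B -> rdot (A x) y = rdot x (B y).
Proof. by move=> AB; congr Re; exact: AB. Qed.

Definition finite_functional : set ((H -> H) -> R^o) := range flist.

Lemma finite_functionalD g g' : finite_functional g -> finite_functional g' ->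
  finite_functional (g + g').
Proof. by move=> [l _ <-] [l' _ <-]; exists (l ++ l'); rewrite ?flist_cat. Qed.

Lemma finite_functionalZ (t : R) g : finite_functional g -> finite_functional (t *: g).
Proof. by move=> [l _ <-]; exists (scale_list t l); rewrite ?flist_scale. Qed.

End Functionals.

(** * Algebra of bounded operators *)

Section BoundedOperators.
Context {R : realType} {H : completeNormedModType R[i]}.

Lemma bounded_operator_lin (a : R[i]) (A B : H -> H) :
  bounded_operator A -> bounded_operator B -> bounded_operator (a *: A + B).
Proof.
move=> /bounded_operatorP[Al [C C0 AC]] /bounded_operatorP[Bl [D D0 BD]].
apply/bounded_operatorP; split=> [k x y|].
  rewrite !fctE Al Bl !scalerDr !scalerA [a * k]mulrC.
  by rewrite addrACA.
exists (Re `|a| * C + D).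
  by rewrite addr_ge0// mulr_ge0// -ler0c RRe_real ?normr_real.
move=> x; rewrite !fctE mulrDl; apply: le_trans (ler_rnormD _ _) (lerD _ (BD x)).
rewrite /rnorm normrZ -[`|a|](RRe_real (normr_real a)) ReZ -mulrA ler_wpM2l//.
  by rewrite -ler0c RRe_real ?normr_real.
exact: AC.
Qed.

Lemma bounded_operator_comp (A B : H -> H) :
  bounded_operator A -> bounded_operator B -> bounded_operator (A \o B).
Proof.
move=> [Al Ac] [Bl Bc]; split=> [k x y|x]; first by rewrite /= Bl Al.
exact: continuous_comp (Bc x) (Ac _).
Qed.

Lemma bounded_operator_id : bounded_operator (@idfun H).
Proof. by split=> // x; exact: cvg_id. Qed.

Lemma bounded_operator_scale (a : R[i]) : bounded_operator (fun x : H => a *: x).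
Proof.
have -> : (fun x : H => a *: x) = (a - 1) *: idfun + idfun.
  by apply/funext => x; rewrite !fctE scalerBl scale1r subrK.
exact: bounded_operator_lin bounded_operator_id bounded_operator_id.
Qed.

Lemma bounded_operatorD (A : H -> H) x y : bounded_operator A -> A (x + y) = A x + A y.
Proof. by move=> [Al _]; have := Al 1 x y; rewrite !scale1r. Qed.

Lemma bounded_operator0 (A : H -> H) : bounded_operator A -> A 0 = 0.
Proof.
by move=> Ab; apply: (addrI (A 0)); rewrite -bounded_operatorD// !addr0.
Qed.

Lemma bounded_operatorZ (A : H -> H) a x : bounded_operator A -> A (a *: x) = a *: A x.
Proof.
by move=> Ab; have := Ab.1 a x 0; rewrite (bounded_operator0 Ab) !addr0.
Qed.

End BoundedOperators.

(** * Elements of a von Neumann algebra built from forms and from Hahn-Banach *)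

Section VonNeumann.
Context {R : realType} {H : completeNormedModType R[i]}.
Variable dot : {dot H for @conjc R}.
Hypothesis Hhilbert : hilbert_norm dot.
Variable M : set (H -> H).
Hypothesis MvN : von_neumann_algebra dot M.
Local Notation rdot := (rdot dot).
Local Notation flist := (flist dot).

Lemma vnP A : M A <->
  bounded_operator A /\ forall B, commutant M B -> B \o A = A \o B.
Proof. by have [_ _ ME] := MvN; rewrite -[in X in X <-> _]ME. Qed.

Lemma vn_bounded A : M A -> bounded_operator A.
Proof. by have [h _ _] := MvN; exact: h. Qed.

Lemma vn_lin a A B : M A -> M B -> M (a *: A + B).
Proof.
move=> /vnP[Ab AC] /vnP[Bb BC]; apply/vnP; split; first exact: bounded_operator_lin.
move=> D DM; apply/funext => x; have [Db _] := DM.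
have /(congr1 (@^~ x)) := AC D DM; have /(congr1 (@^~ x)) := BC D DM.
rewrite /= !fctE bounded_operatorD// bounded_operatorZ//.
by move=> -> ->.
Qed.

Lemma vn_comp A B : M A -> M B -> M (A \o B).
Proof.
move=> /vnP[Ab AC] /vnP[Bb BC]; apply/vnP; split; first exact: bounded_operator_comp.
move=> D DM; rewrite [in LHS]compA AC// -[in LHS]compA BC//.
Qed.

Lemma vn_id : M idfun.
Proof. by apply/vnP; split=> [|B _]; [exact: bounded_operator_id|exact/funext]. Qed.

Lemma vn_zero : M 0.
Proof.
rewrite (_ : 0 = (-1) *: idfun + idfun); first exact: vn_lin vn_id vn_id.
by rewrite scaleN1r addNr.
Qed.

Lemma vn_scale a A : M A -> M (a *: A).
Proof. by move=> MA; rewrite -[_ *: _]addr0; exact: vn_lin vn_zero. Qed.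

Lemma vn_sub A B : M A -> M B -> M (A - B).
Proof. by move=> MA MB; rewrite addrC -scaleN1r; exact: vn_lin. Qed.

Lemma commutant_scale a : commutant M (fun x : H => a *: x).
Proof.
split=> [|A MA]; first exact: bounded_operator_scale.
by apply/funext => x /=; rewrite bounded_operatorZ//; exact: vn_bounded.
Qed.

(** Compatibility with the commutant says that the represented operator commutes with it, so it lies
    in the bicommutant, which is [M]. Scalars belong to the commutant, which supplies the rule for
    ['i]. *)
Lemma vn_bilinear (b : H -> H -> R) (C : R) : 0 <= C ->
  (forall x y z, b (x + y) z = b x z + b y z) ->
  (forall x y z, b x (y + z) = b x y + b x z) ->
  (forall (t : R) x y, b (t%:C *: x) y = t * b x y) ->
  (forall (t : R) x y, b x (t%:C *: y) = t * b x y) ->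
  (forall x y, `|b x y| <= C * rnorm x * rnorm y) ->
  (forall B B', commutant M B -> adjoint dot B B' -> forall x y,
     b (B x) y = b x (B' y)) ->
  exists A : H -> H, [/\ M A, forall x y, b x y = rdot (A x) y &
    forall x, rnorm (A x) <= C * rnorm x].
Proof.
move=> C0 bDl bDr bZl bZr bC bM.
have [|A [Al bA AC]] := bilinear_operator Hhilbert bDl bDr bZl bZr _ bC.
  (* Multiplication by -i is the adjoint of multiplication by i. *)
  move=> x y; rewrite (bM _ (fun x => (- 'i) *: x) (commutant_scale _)); last first.
    move=> u v; rewrite dotZl dotZr; congr (_ * _).
    by apply/eqP; rewrite eq_complex/= oppr0 opprK !eqxx.
  by rewrite scaleNr -scaleN1r (_ : -1 = (-1)%:C) ?bZr ?mulN1r// rmorphN1.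
exists A; split=> //; apply/vnP; split.
  by apply/bounded_operatorP; split=> //; exists C.
move=> B BM; apply/funext => x /=; apply: (rdot_inj (dot := dot)) => y.
have [Bb _] := BM; have [B' _ BB'] := bounded_adjoint Hhilbert Bb.
by rewrite -[RHS]bA (bM _ _ BM BB') bA (rdot_adjoint _ _ BB').
Qed.

(* A functional dominated by q induces a bounded form compatible with the
   commutant of M, that is, an element of M. *)
Lemma sublinear_attained (q : ((H -> H) -> R^o) -> R) l :
  sublinear_on (finite_functional dot) q ->
  (forall x y, q (flist [:: (x, y)]) <= rnorm x * rnorm y) ->
  (forall g, finite_functional dot g -> (forall A, M A -> g A = 0) -> q g <= 0) ->
  exists A, [/\ M A, operator_unit_ball A,
    forall g, finite_functional dot g -> g A <= q g & flist l A = q (flist l)].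
Proof.
move=> qS q1 q0.
have Fl l' : finite_functional dot (flist l') by exists l'.
have [f [fD fZ fq fl]] := hahn_banach (@finite_functionalD _ _ dot)
  (@finite_functionalZ _ _ dot) qS (Fl l).
have FN g : finite_functional dot g -> finite_functional dot (- g).
  by move=> Fg; rewrite -scaleN1r; exact: finite_functionalZ.
have fN g : finite_functional dot g -> f (- g) = - f g.
  by move=> Fg; rewrite -scaleN1r fZ// mulN1r.
(* Thus [f] sees only restrictions to [M], and identities valid on [M], such as linearity of
   operators or commutation with the commutant, pass to the form [b]. *)
have f0 g : finite_functional dot g -> (forall A, M A -> g A = 0) -> f g = 0.
  move=> Fg g0; apply/eqP; rewrite eq_le (le_trans (fq _ Fg)) ?q0//=.
  rewrite -oppr_le0 -fN// (le_trans (fq _ (FN _ Fg))) ?q0//; first exact: FN.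
  by move=> A MA; rewrite fctE g0// oppr0.
have f_ext g g' : finite_functional dot g -> finite_functional dot g' ->
    (forall A, M A -> g A = g' A) -> f g = f g'.
  move=> Fg Fg' gg'; apply/eqP; rewrite -subr_eq0 -fN// -fD//; last exact: FN.
  rewrite f0//; first by apply: finite_functionalD => //; exact: FN.
  by move=> A MA; rewrite !fctE gg'// subrr.
have fDl l1 l2 : f (flist (l1 ++ l2)) = f (flist l1) + f (flist l2).
  by rewrite flist_cat fD.
pose b x y := f (flist [:: (x, y)]).
have bC x y : `|b x y| <= 1 * rnorm x * rnorm y.
  rewrite mul1r ler_norml (le_trans (fq _ (Fl _))) ?q1// andbT.
  rewrite lerNl -fN// -[- _]scaleN1r -flist_scale.
  rewrite (le_trans (fq _ (Fl _)))//= (le_trans (q1 _ _))//.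
  by rewrite rnormZ normrN1 mul1r.
have [|||||A [MA bA AC]] := @vn_bilinear b 1 ler01 _ _ _ _ bC.
- move=> x y z; rewrite /b -fDl; apply: f_ext => // A MA.
  by rewrite flist_cat fctE !flist1 bounded_operatorD ?rdotDl//; exact: vn_bounded.
- move=> x y z; rewrite /b -fDl; apply: f_ext => // A MA.
  by rewrite flist_cat fctE !flist1 rdotDr.
- move=> t x y; rewrite /b -fZ//; apply: f_ext => // [|A MA].
    exact: finite_functionalZ.
  by rewrite fctE !flist1 bounded_operatorZ ?rdotZl//; exact: vn_bounded.
- move=> t x y; rewrite /b -fZ//; apply: f_ext => // [|A MA].
    exact: finite_functionalZ.
  by rewrite fctE !flist1 rdotZr.
- move=> B B' [Bb BM] BB' x y; apply: f_ext => // A MA.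
  rewrite !flist1 -(rdot_adjoint _ _ BB'); have /(congr1 (@^~ x)) /= -> // := BM A MA.
have fA l' : f (flist l') = flist l' A.
  elim: l' => [|[x y] l' IH].
    by rewrite f0// ?/flist ?big_nil// => B _; rewrite /flist big_nil.
  by rewrite flist_cons fD// IH fctE flist1; congr (_ + _); exact: bA.
exists A; split=> //.
- by apply/rnorm_unit_ball => x; rewrite -[leRHS]mul1r.
- by move=> _ [l' _ <-]; rewrite -fA; exact: fq.
- by rewrite -fA.
Qed.

(* The least mass of a representation is the norm on the unit ball of M. *)
Lemma finite_functional_mass (l : seq (H * H)) (e e' : R) :
  (forall A, M A -> operator_unit_ball A -> flist l A <= e) -> e < e' ->
  exists2 l', forall A, M A -> flist l' A = flist l A & mass l' < e'.
Proof.
move=> le ee'.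
pose E g := [set mass l' | l' in [set l' | forall A, M A -> flist l' A = g A]].
have Elb g : lbound (E g) 0 by move=> _ [l' _ <-]; exact: mass_ge0.
pose q g := inf (E g).
have q_le g l' : (forall A, M A -> flist l' A = g A) -> q g <= mass l'.
  by move=> gl'; apply: ge_inf; [exists 0|exists l'].
have q_ge g m : finite_functional dot g ->
    (forall l', (forall A, M A -> flist l' A = g A) -> m <= mass l') -> m <= q g.
  by move=> [l0 _ <-] h; apply: lb_le_inf; [exists (mass l0), l0|move=> _ [l' /h ? <-]].
have q0 g : finite_functional dot g -> (forall A, M A -> g A = 0) -> q g <= 0.
  move=> Fg g0; have := q_le g [::]; rewrite /mass big_nil; apply => A MA.
  by rewrite g0// /flist big_nil.
have qS : sublinear_on (finite_functional dot) q.
  apply: sublinear_onI => [|g g' Fg Fg'|_|t g t0 Fg].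
  - exact: finite_functionalZ.
  - rewrite -lerBlDr; apply: (q_ge _ _ Fg) => l1 gl1.
    rewrite lerBlDr [leRHS]addrC -lerBlDr; apply: (q_ge _ _ Fg') => l2 gl2.
    rewrite lerBlDr [leRHS]addrC -mass_cat; apply: q_le => A MA.
    by rewrite flist_cat !fctE gl1 ?gl2.
  - have F0 : finite_functional dot 0.
      by exists [::] => //; apply/funext => A; rewrite /flist big_nil.
    apply/eqP; rewrite eq_le q0//=; apply: (q_ge _ _ F0) => l' _; exact: mass_ge0.
  - rewrite -ler_pdivrMl//; apply: (q_ge _ _ Fg) => l' gl'; rewrite ler_pdivrMl//.
    rewrite -[t in leRHS]gtr0_norm// -mass_scale; apply: q_le => A MA.
    by rewrite flist_scale !fctE gl'.
(* The least mass [q (flist l)] is the value of [flist l] at an element of the unit ball of [M],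
   hence at most [e]. *)
have [|A [MA A1 _ Al]] := @sublinear_attained q l qS _ q0.
  by move=> x y; rewrite (le_trans (q_le _ [:: (x, y)] _))// /mass big_seq1.
have : q (flist l) < e' by rewrite -Al (le_lt_trans (le _ MA A1)).
move=> /inf_lt[|_ [l' ll' <-] ?]; last by exists l'.
by exists (mass l), l.
Qed.

End VonNeumann.

(** * Complex limits by real and imaginary parts; geometric bounds *)

Section ComplexLimits.
Context {R : realType}.

Lemma normc_ge_Im (z : R[i]) : `|Im z|%:C <= `|z|.
Proof.
have := normc_ge_Re (z * 'i); rewrite ReiNIm normrN normrM.
by rewrite [`|'i|]normc_def/= expr0n expr1n add0r sqrtr1 mulr1.
Qed.

Lemma normc_le_ReIm (z : R[i]) : `|z| <= (`|Re z| + `|Im z|)%:C.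
Proof.
rewrite [in leLHS](complexE z) (le_trans (ler_normD _ _))// normrM.
rewrite [`|'i|]normc_def/= expr0n expr1n add0r sqrtr1 mul1r !normc_real.
by rewrite rmorphD.
Qed.

Lemma ImD (a b : R[i]) : Im (a + b) = Im a + Im b. Proof. by case: a; case: b. Qed.
Lemma ImN (a : R[i]) : Im (- a) = - Im a. Proof. by case: a. Qed.
Lemma ImB (a b : R[i]) : Im (a - b) = Im a - Im b. Proof. by rewrite ImD ImN. Qed.
Lemma ReB (a b : R[i]) : Re (a - b) = Re a - Re b. Proof. by rewrite ReD ReN. Qed.

Lemma gtc0P (e : R[i]) : 0 < e -> exists2 r : R, 0 < r & e = r%:C.
Proof.
rewrite ltcE/= => /andP[/eqP e0 ep]; exists (Re e) => //.
by case: e e0 {ep} => a c /= ->.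
Qed.

Lemma cvg_complexP {T : Type} {F : set_system T} {FF : Filter F}
    (f : T -> R[i]^o) (l : R[i]^o) :
  f x @[x --> F] --> l <->
  Re (f x) @[x --> F] --> Re l /\ Im (f x) @[x --> F] --> Im l.
Proof.
split=> [/cvgrPdist_le fl|[/cvgrPdist_le fRe /cvgrPdist_le fIm]].
  split; apply/cvgrPdist_le => e e0.
    have e0' : 0 < e%:C by rewrite ltcR.
    apply: filterS (fl _ e0') => x /= xl.
    by rewrite -ReB -lecR (le_trans (normc_ge_Re _)).
  have e0' : 0 < e%:C by rewrite ltcR.
  apply: filterS (fl _ e0') => x /= xl.
  by rewrite -ImB -lecR (le_trans (normc_ge_Im _)).
apply/cvgrPdist_le => _ /gtc0P[e e0 ->].
have e2 : 0 < e / 2 by rewrite divr_gt0.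
apply: filterS2 (fRe _ e2) (fIm _ e2) => x /= xRe xIm.
apply: le_trans (normc_le_ReIm _) _; rewrite lecR ReB ImB.
by rewrite [leRHS](splitr e) lerD.
Qed.

Lemma Re_sum I (r : seq I) (P : pred I) (F : I -> R[i]) :
  Re (\sum_(i <- r | P i) F i) = \sum_(i <- r | P i) Re (F i).
Proof. by apply: big_morph => //; exact: ReD. Qed.

Lemma Im_sum I (r : seq I) (P : pred I) (F : I -> R[i]) :
  Im (\sum_(i <- r | P i) F i) = \sum_(i <- r | P i) Im (F i).
Proof. by apply: big_morph => //; exact: ImD. Qed.

Lemma cvgn_dist (u : nat -> R) l : u n @[n --> \oo] --> l <->
  forall e, 0 < e -> exists N, forall n, (N <= n)%N -> `|u n - l| <= e.
Proof.
split=> [/cvgrPdist_le ul e e0|ul].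
  by have [N _ Ne] := ul _ e0; exists N => n /Ne /=; rewrite distrC.
apply/cvgrPdist_le => e e0; have [N Ne] := ul _ e0.
by exists N => // n /Ne; rewrite distrC.
Qed.

Lemma cvg_normr_le (u : nat -> R) l s e N : u n @[n --> \oo] --> l ->
  (forall n, (N <= n)%N -> `|u n - s| <= e) -> `|l - s| <= e.
Proof.
move=> /cvgn_dist ul us; apply/ler_addgt0Pr => d d0; have [K Kd] := ul _ d0.
have := Kd _ (leq_maxr N K); have := us _ (leq_maxl N K).
set v := u _ => h1 h2; rewrite -[l - s](subrKA v) addrC.
by apply: le_trans (ler_normD _ _) _; rewrite lerD// distrC.
Qed.

Lemma series_geom2 m : \sum_(j < m) (2^-1 : R) ^+ j <= 2.
Proof.
suff -> : \sum_(j < m) (2^-1 : R) ^+ j = 2 - 2 * 2^-1 ^+ m.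
  by rewrite lerBlDr lerDl mulr_ge0// exprn_ge0.
elim: m => [|m IH]; first by rewrite big_ord0 expr0 mulr1 subrr.
by rewrite big_ord_recr/= IH exprS; field.
Qed.

Lemma geom2_lt (e : R) : 0 < e -> exists N, forall n, (N <= n)%N -> (2^-1 : R) ^+ n <= e.
Proof.
move=> e0; have : (2^-1 : R) ^+ n @[n --> \oo] --> (0 : R).
  by apply: cvg_expr; rewrite ger0_norm// invf_lt1// ltr1n.
move=> /cvgn_dist/(_ _ e0)[N Ne]; exists N => n /Ne.
by rewrite subr0 ger0_norm// exprn_ge0.
Qed.

End ComplexLimits.

(** * Stringing finite blocks into one sequence *)

Section Concatenation.
Context {T : Type} (x0 : T) (b : nat -> seq T).

Let F k := flatten (mkseq b k).

Let FS k : F k.+1 = F k ++ b k.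
Proof. by rewrite /F mkseqS -cats1 flatten_cat/= cats0. Qed.

Let F_prefix k m : (k <= m)%N -> exists s, F m = F k ++ s.
Proof.
elim: m => [|m IH]; first by rewrite leqn0 => /eqP ->; exists [::]; rewrite cats0.
rewrite leq_eqVlt => /predU1P[->|]; first by exists [::]; rewrite cats0.
by rewrite ltnS => /IH[s Fm]; exists (s ++ b m); rewrite FS Fm catA.
Qed.

Lemma concatenation : (forall k, (0 < size (b k))%N) ->
  exists (s : nat -> T) (N : nat -> nat), (forall k, (k <= N k)%N) /\
    forall (V : nmodType) (G : T -> V) k,
      \sum_(0 <= n < N k) G (s n) = \sum_(j < k) \sum_(x <- b j) G x.
Proof.
move=> b0.
have Fk k : (k <= size (F k))%N.
  by elim: k => // k IH; rewrite FS size_cat -addn1 leq_add.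
(* Blocks are nonempty, so [F n.+1] has more than [n] entries and the default [x0] is never read. *)
exists (fun n => nth x0 (F n.+1) n), (fun k => size (F k)); split=> // V G k.
have -> : \sum_(j < k) \sum_(x <- b j) G x = \sum_(x <- F k) G x.
  elim: k => [|k IH]; first by rewrite big_ord0 big_nil.
  by rewrite big_ord_recr/= IH FS big_cat.
rewrite (big_nth x0); apply: eq_big_nat => n /andP[_ nk]; congr G.
have [nk'|/ltnW kn] := leqP n.+1 k.
  by have [s ->] := F_prefix nk'; rewrite nth_cat Fk.
by have [s ->] := F_prefix kn; rewrite nth_cat nk.
Qed.

End Concatenation.

(** * Normal functionals: approximation by finite ones and norm closedness *)

Section Predual.
Context {R : realType} {H : completeNormedModType R[i]}.
Variable dot : {dot H for @conjc R}.
Hypothesis Hhilbert : hilbert_norm dot.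
Variable M : set (H -> H).
Hypothesis MvN : von_neumann_algebra dot M.
Local Notation rdot := (rdot dot).
Local Notation flist := (flist dot).

Lemma square_summableP (xi : nat -> H) :
  square_summable xi <-> cvgn (series (fun k => rnorm (xi k) ^+ 2)).
Proof.
split=> [/cvg_ex[l /cvg_complexP[lRe _]]|/cvg_ex[l lR]]; apply/cvg_ex.
  exists (Re l); apply: cvg_trans lRe; apply: near_eq_cvg; apply: nearW => n.
  by rewrite /series/= Re_sum; apply: eq_bigr => k _; rewrite rnormE -rmorphXn.
exists l%:C; apply/cvg_complexP; split.
  apply: cvg_trans lR; apply: near_eq_cvg; apply: nearW => n.
  by rewrite /series/= Re_sum; apply: eq_bigr => k _; rewrite rnormE -rmorphXn.
apply: cvg_near_cst; apply: nearW => n; rewrite /series/= Im_sum.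
by rewrite big1// => k _; rewrite rnormE -rmorphXn.
Qed.

Lemma rdot_norm_le (A : H -> H) K x y : 0 <= K -> (forall z, rnorm (A z) <= K * rnorm z) ->
  `|rdot (A x) y| <= K * ((rnorm x ^+ 2 + rnorm y ^+ 2) / 2).
Proof.
move=> K0 AK; apply: le_trans (cauchy_schwarz Hhilbert _ _) _.
apply: le_trans (ler_wpM2r (rnorm_ge0 y) (AK x)) _; rewrite -mulrA ler_wpM2l//.
by have := sqr_ge0 (rnorm x - rnorm y); rewrite sqrrB; lra.
Qed.

(** Truncate the series: by Cauchy-Schwarz and the arithmetic-geometric mean inequality its tail is
    at most half the tail of the square sums, uniformly on the unit ball. *)
Lemma predual_approx (rho : (H -> H) -> R[i]^o) (e : R) : predual dot M rho -> 0 < e ->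
  exists l, forall A, M A -> operator_unit_ball A -> `|Re (rho A) - flist l A| <= e.
Proof.
move=> [xi [eta [/square_summableP xi2 /square_summableP eta2 rhoE]]] e0.
pose u k := (rnorm (xi k) ^+ 2 + rnorm (eta k) ^+ 2) / 2.
have u0 k : 0 <= u k by rewrite divr_ge0// addr_ge0// sqr_ge0.
have cu : cvgn (series u).
  have -> : u = 2^-1 *: ((fun k => rnorm (xi k) ^+ 2) + (fun k => rnorm (eta k) ^+ 2)).
    by apply/funext => k; rewrite /u mulrC.
  by apply: is_cvg_seriesZ; rewrite seriesD; exact: is_cvgD.
have hu : {homo series u : n m / (n <= m)%N >-> n <= m}.
  by move=> n m nm; rewrite -subr_ge0 sub_series_geq// sumr_ge0.
have /cvgn_dist/(_ _ e0)[N Ne] := cu.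
exists [seq (xi k, eta k) | k <- index_iota 0 N] => A MA /rnorm_unit_ball A1.
have /cvg_complexP[rhoRe _] := rhoE A MA.
pose v k := rdot (A (xi k)) (eta k).
have vE n : Re (series (fun k => dot (A (xi k)) (eta k) : R[i]^o) n) = series v n.
  by rewrite /series/= Re_sum.
have -> : flist [seq (xi k, eta k) | k <- index_iota 0 N] A = series v N.
  by rewrite /flist big_map.
apply: (@cvg_normr_le _ (series v) _ _ _ N) => [|m Nm].
  apply: cvg_trans rhoRe; apply: near_eq_cvg; apply: nearW => n; exact: vE.
rewrite sub_series_geq//; apply: le_trans (ler_norm_sum _ _ _) _.
apply: (@le_trans _ _ (\sum_(N <= k < m) u k)).
  apply: ler_sum => k _; rewrite -[u k]mul1r; apply: rdot_norm_le => // z.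
  by rewrite mul1r.
rewrite -sub_series_geq//; apply: le_trans (Ne N (leqnn _)).
rewrite distrC ler_normr; apply/orP; left.
by rewrite lerD2r; exact: nondecreasing_cvgn_le.
Qed.

Lemma predual_lin rho a A B : predual dot M rho -> M A -> M B ->
  rho (a *: A + B) = a * rho A + rho B.
Proof.
move=> [xi [eta [_ _ rhoE]]] MA MB.
have h := rhoE _ (vn_lin MvN a MA MB).
apply: (cvg_unique _ h); first exact: norm_hausdorff.
apply: cvg_trans (cvgD (cvgM (cvg_cst (a : R[i]^o)) (rhoE A MA)) (rhoE B MB)).
apply: near_eq_cvg; apply: nearW => n.
rewrite [RHS](_ : _ = a * series (fun k => dot (A (xi k)) (eta k)) n +
  series (fun k => dot (B (xi k)) (eta k)) n)//.
rewrite /series/= mulr_sumr -big_split/=; apply: eq_bigr => k _.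
by rewrite linearDl linearZl_LR.
Qed.

Lemma predual0 rho : predual dot M rho -> rho 0 = 0.
Proof.
move=> rhoM; have M0 := vn_zero MvN; have := predual_lin 1 rhoM M0 M0.
by rewrite scaler0 addr0 mul1r => h; apply: (addrI (rho 0)); rewrite addr0 -h.
Qed.

Lemma predualZ rho a A : predual dot M rho -> M A -> rho (a *: A) = a * rho A.
Proof.
move=> rhoM MA; have := predual_lin a rhoM MA (vn_zero MvN).
by rewrite predual0// !addr0.
Qed.

Lemma predual_vector x y : predual dot M (fun A => dot (A x) y).
Proof.
pose single z := (fun k : nat => if k == 0%N then z else 0 : H).
have E (V : zmodType) (f : nat -> V) n : (forall k, f k.+1 = 0) -> series f n.+1 = f 0%N.
  by move=> f0; rewrite /series/= big_nat_recl// big1 ?addr0// => k _; exact: f0.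
have ss z : square_summable (single z).
  apply/cvg_ex; exists (`|single z 0%N| ^+ 2); apply: cvg_near_cst.
  by exists 1%N => // -[//|n] _; rewrite E// => k; rewrite /single/= normr0 expr0n.
exists (single x), (single y); split=> // A MA; apply: cvg_near_cst.
by exists 1%N => // -[//|n] _; rewrite E// => k; rewrite /single/= linear0r.
Qed.

(** Rescaling x by s and y by 1/s with s^2 = |y|/|x| makes both norms equal, so that a mass bound
    becomes the square summability which [predual] demands. Nonemptiness is for [concatenation]. *)
Lemma balanced_list (l : seq (H * H)) : exists l' : seq (H * H),
  [/\ (0 < size l')%N, forall A, M A -> flist l' A = flist l A &
    \sum_(p <- l') (rnorm p.1 ^+ 2 + rnorm p.2 ^+ 2) <= 2 * mass l].
Proof.
elim: l => [|[x y] l [l' [l'0 l'l l'm]]].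
  exists [:: (0, 0)]; split=> // [A MA|].
    by rewrite /flist big_seq1 big_nil rdot0r.
  by rewrite big_seq1/= rnorm0 /mass big_nil mulr0 expr0n addr0.
suff [p pA pm] : exists2 p : H * H, forall A, M A -> rdot (A p.1) p.2 = rdot (A x) y &
    rnorm p.1 ^+ 2 + rnorm p.2 ^+ 2 <= 2 * (rnorm x * rnorm y).
  exists (p :: l'); split=> // [A MA|].
    by rewrite /flist !big_cons pA// [X in _ + X]l'l.
  by rewrite /mass !big_cons mulrDr lerD.
have zero z : rnorm z = 0 -> z = 0 :> H.
  by move=> z0; apply/eqP; rewrite -normr_eq0 rnormE z0.
have xy0 : 0 <= 2 * (rnorm x * rnorm y) by rewrite !mulr_ge0// rnorm_ge0.
have [x0|x0] := eqVneq (rnorm x) 0.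
  exists (0, 0) => [A MA|]; last by rewrite /= rnorm0 expr0n addr0.
  by rewrite (zero _ x0)/= (bounded_operator0 (vn_bounded MvN MA)) !rdot0l.
have [y0|y0] := eqVneq (rnorm y) 0.
  exists (0, 0) => [A MA|]; last by rewrite /= rnorm0 expr0n addr0.
  by rewrite (zero _ y0)/= !rdot0r.
have xp : 0 < rnorm x by rewrite lt_def x0 rnorm_ge0.
have yp : 0 < rnorm y by rewrite lt_def y0 rnorm_ge0.
pose s := Num.sqrt (rnorm y / rnorm x).
have sp : 0 < s by rewrite sqrtr_gt0 divr_gt0.
have s2 : s ^+ 2 = rnorm y / rnorm x by rewrite sqr_sqrtr// ltW// divr_gt0.
exists (s%:C *: x, s^-1%:C *: y) => [A MA|/=].
  rewrite /= (bounded_operatorZ _ _ (vn_bounded MvN MA)) rdotZl rdotZr.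
  by rewrite mulrA divff ?gt_eqF// mul1r.
rewrite !rnormZ gtr0_norm// gtr0_norm ?invr_gt0// !exprMn exprVn s2.
rewrite [leLHS](_ : _ = 2 * (rnorm x * rnorm y))//; field.
by rewrite x0 y0.
Qed.

(* The predual is norm closed in the dual of M. The increments of a fast
   approximating sequence of finite functionals have representations of small
   mass, and these are strung together into a single series. *)
Lemma predual_closed (phi : (H -> H) -> R[i]^o) :
  (forall a A, M A -> phi (a *: A) = a * phi A) ->
  (forall e : R, 0 < e -> exists l, forall A, M A -> operator_unit_ball A ->
     `|Re (phi A) - flist l A| <= e) ->
  predual dot M phi.
Proof.
move=> phiZ phi_approx; pose c k : R := 2^-1 ^+ k.
have c0 k : 0 < c k by rewrite exprn_gt0.
have /choice[L LE] k := phi_approx (c k) (c0 k).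
have step k : exists l' : seq (H * H), [/\ (0 < size l')%N,
    forall A, M A -> flist l' A = flist (L k.+1) A - flist (L k) A &
    \sum_(p <- l') (rnorm p.1 ^+ 2 + rnorm p.2 ^+ 2) <= 6 * c k].
  have diffE A : flist (L k.+1 ++ scale_list (-1) (L k)) A = flist (L k.+1) A - flist (L k) A.
    by rewrite flist_cat flist_scale !fctE scaleN1r.
  (* Two consecutive approximants differ by at most c k + c (k+1) <= 2 c k on the unit ball; 3
     leaves room for the strict inequality, and balancing doubles it to 6. *)
  have [A MA A1||l1 l1E l1m] := finite_functional_mass Hhilbert MvN
      (l := L k.+1 ++ scale_list (-1) (L k)) (e := 2 * c k) (e' := 3 * c k).
  - rewrite diffE; have := LE k A MA A1; have := LE k.+1 A MA A1.
    have : c k.+1 <= c k by rewrite /c exprS ger_pMl// invf_le1// ler1n.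
    rewrite !ler_norml => h /andP[h1 h2] /andP[h3 h4]; lra.
  - by rewrite ltr_pM2r// ltr_nat.
  have [l2 [l20 l2E l2m]] := balanced_list l1; exists l2; split=> // [A MA|].
    by rewrite l2E// l1E// diffE.
  by apply: le_trans l2m _; move/ltW: l1m; lra.
have /choice[d dE] := step; have [l0 [l00 l0E _]] := balanced_list (L 0%N).
(* Block 0 represents [L 0], so the first k+1 blocks telescope to [L k]. The 12 in [C] below is 6
   times the bound 2 on the geometric series. *)
pose b k := if k is k'.+1 then d k' else l0.
have b_pos k : (0 < size (b k))%N by case: k => //= k; have [] := dE k.
have bE A k : M A -> \sum_(j < k.+1) flist (b j) A = flist (L k) A.
  move=> MA; elim: k => [|k IH]; first by rewrite big_ord_recl big_ord0 addr0 l0E.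
  by rewrite big_ord_recr/= IH; have [_ -> // _] := dE k; rewrite addrC subrK.
have [s [N [kN sE]]] := concatenation (0, 0) b_pos.
pose sq (p : H * H) := rnorm p.1 ^+ 2 + rnorm p.2 ^+ 2.
have sq0 p : 0 <= sq p by rewrite addr_ge0// sqr_ge0.
pose C := \sum_(p <- l0) sq p + 12.
have bC k : \sum_(j < k) \sum_(p <- b j) sq p <= C.
  case: k => [|k]; first by rewrite big_ord0 addr_ge0// sumr_ge0.
  rewrite big_ord_recl/= lerD2l; apply: (@le_trans _ _ (\sum_(j < k) 6 * c j)).
    by apply: ler_sum => j _; have [] := dE j.
  by rewrite -mulr_sumr; have := series_geom2 (R := R) k; rewrite -/c; lra.
have hs (u : nat -> R) : (forall k, 0 <= u k) -> {homo series u : n m / (n <= m)%N >-> n <= m}.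
  by move=> u0 n m nm; rewrite -subr_ge0 sub_series_geq// sumr_ge0.
have cvg_le (u : nat -> R) : (forall k, 0 <= u k <= sq (s k)) -> cvgn (series u).
  move=> u_sq; have u0 k : 0 <= u k by have /andP[] := u_sq k.
  apply: nondecreasing_is_cvgn; first exact: hs.
  exists C => _ [n _ <-]; apply: le_trans (bC n); rewrite -sE.
  apply: le_trans (hs _ u0 _ _ (kN n)) _; apply: ler_sum => k _.
  by have /andP[] := u_sq k.
have main A : M A -> series (fun k => rdot (A (s k).1) (s k).2) n @[n --> \oo] --> Re (phi A).
  move=> MA; have /bounded_operatorP[_ [K' K'0 AK']] := vn_bounded MvN MA.
  pose K := K' + 1; have K0 : 0 < K by rewrite ltr_wpDl.
  have AK x : rnorm (A x) <= K * rnorm x.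
    by apply: le_trans (AK' x) _; rewrite ler_wpM2r ?rnorm_ge0// lerDl.
  have Lphi k : `|flist (L k) A - Re (phi A)| <= K * c k.
    have B1 : operator_unit_ball (K^-1%:C *: A).
      apply/rnorm_unit_ball => x; rewrite fctE rnormZ gtr0_norm ?invr_gt0//.
      by rewrite ler_pdivrMl.
    have := LE k _ (vn_scale MvN _ MA) B1; rewrite phiZ// ReZ.
    have -> : flist (L k) (K^-1%:C *: A) = K^-1 * flist (L k) A.
      by rewrite /flist mulr_sumr; apply: eq_bigr => p _; rewrite fctE rdotZl.
    by rewrite -mulrBr normrM gtr0_norm ?invr_gt0// ler_pdivrMl// distrC.
  apply/cvgn_dist => e e0.
  have K2 : 0 < e / 2 / K by rewrite !divr_gt0.
  have [N1 N1e] := geom2_lt K2.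
  have csq : cvgn (series (sq \o s)) by apply: cvg_le => k; rewrite sq0 lexx.
  have /cvgn_dist/(_ _ K2)[N2 N2e] := csq.
  (* Cut at the end of block k, where the partial sum is [flist (L k) A]: one half of the error is
     the tail of the square sums, the other is the distance from [L k] to [phi]. *)
  pose k := maxn N1 N2; exists (N k.+1) => n kn.
  set S := series _; have -> : S n - Re (phi A) =
      (S n - S (N k.+1)) + (flist (L k) A - Re (phi A)).
    rewrite [X in _ = _ - X + _](_ : _ = flist (L k) A) ?addrA ?subrK// /S.
    by rewrite -bE// -(sE _ (fun p => rdot (A p.1) p.2)).
  apply: le_trans (ler_normD _ _) _; rewrite [leRHS]splitr lerD//; last first.
    apply: le_trans (Lphi k) _.
    by rewrite -ler_pdivlMl// mulrC; apply: N1e; exact: leq_maxl.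
  rewrite sub_series_geq//; apply: le_trans (ler_norm_sum _ _ _) _.
  apply: (@le_trans _ _ (\sum_(N k.+1 <= j < n) K * sq (s j))).
    apply: ler_sum => j _; apply: le_trans (rdot_norm_le _ _ (ltW K0) AK) _.
    by rewrite ler_wpM2l ?(ltW K0)// -/(sq (s j)); have := sq0 (s j); lra.
  rewrite -mulr_sumr -ler_pdivlMl// [leRHS]mulrC -(sub_series_geq (sq \o s))//.
  have N2k : (N2 <= N k.+1)%N.
    by rewrite (leq_trans _ (kN _))// leqW// leq_maxr.
  apply: le_trans (N2e _ N2k); rewrite distrC ler_normr; apply/orP; left.
  by rewrite lerD2r; apply: nondecreasing_cvgn_le => //; apply: hs => j; exact: sq0.
exists (fun k => (s k).1), (fun k => (s k).2); split.
- by apply/square_summableP/cvg_le => k; rewrite sqr_ge0/= lerDl sqr_ge0.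
- by apply/square_summableP/cvg_le => k; rewrite sqr_ge0/= lerDr sqr_ge0.
- move=> A MA; apply/cvg_complexP; split.
    apply: cvg_trans (main A MA); apply: near_eq_cvg; apply: nearW => n.
    by rewrite /series/= Re_sum.
  (* The imaginary part at A is minus the real part at iA. *)
  have /cvgN := main _ (vn_scale MvN 'i MA).
  have -> : - Re (phi ('i *: A)) = Im (phi A).
    by rewrite phiZ// mulrC ReiNIm opprK.
  apply: cvg_trans; apply: near_eq_cvg; apply: nearW => n.
  rewrite fctE /series/= Im_sum -sumrN; apply: eq_bigr => k _.
  by rewrite fctE rdot_il opprK Im_dot.
Qed.

End Predual.

(** Registers row vectors as a complete space, so that the Baire category theorem applies to
    them. *)
HB.instance Definition _ (R : realType) (n : nat) :=
  Uniform_isComplete.Build 'rV[R]_n (@cauchy_cvg 'rV[R]_n).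

(** * Comeager sets, the Baire property and differences *)

Section BaireProperty.
Context {R : realType} {X : completeNormedModType R}.
Implicit Types (E Z W V : set X).

Definition comeager W := exists G : nat -> set X,
  (forall i, open (G i) /\ dense (G i)) /\ \bigcap_i G i `<=` W.

Lemma comeager_meet W V : comeager W -> open V -> V !=set0 -> V `&` W !=set0.
Proof.
move=> [G [/Baire dG GW]] oV V0; have [x [Vx Gx]] := dG V V0 oV.
by exists x; split=> //; exact: GW.
Qed.

Lemma denseT : dense [set: X].
Proof. by move=> Z [x Ox] _; exists x. Qed.

Lemma comeager_openD Z : open Z -> dense Z -> comeager Z.
Proof. by move=> oO dO; exists (fun=> Z); split=> // x /(_ 0%N); exact. Qed.

Lemma comeager_bigcap (W_ : nat -> set X) : (forall k, comeager (W_ k)) ->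
  comeager (\bigcap_k W_ k).
Proof.
move=> /choice[G GP].
(* A double sequence is enumerated by codes of pairs; other integers contribute the whole space. *)
pose G' m := if unpickle m is Some (k, i) then G k i else setT.
exists G'; split=> [m|x Gx k _].
  rewrite /G'; case: unpickle => [[k i]|]; first by have [h _] := GP k; exact: h.
  by split; [exact: openT|exact: denseT].
have [_] := GP k; apply => i _.
by have := Gx (pickle (k, i)) Logic.I; rewrite /G' pickleK.
Qed.

Lemma comeagerI W1 W2 : comeager W1 -> comeager W2 -> comeager (W1 `&` W2).
Proof.
move=> c1 c2; have [|G [GP GW]] := @comeager_bigcap (fun k => if k is 0%N then W1 else W2).
  by case.
exists G; split=> // x /GW Wx; split; first exact: (Wx 0%N Logic.I).
exact: (Wx 1%N Logic.I).
Qed.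

Lemma open_translate Z (h : X) : open Z -> open [set x | Z (x + h)].
Proof.
move=> oO; apply: (open_comp (f := fun x => x + h)) oO => x _.
exact: (continuousD (@cvg_id _ _) (@cvg_cst _ _ _ _ _)).
Qed.

Lemma comeager_translate W (h : X) : comeager W -> comeager [set x | W (x + h)].
Proof.
move=> [G [GP GW]]; exists (fun i => [set x | G i (x + h)]); split=> [i|x Gx].
  have [oG dG] := GP i; split; first exact: open_translate.
  move=> Z [y Oy] oO; have [||z [Oz Gz]] := dG [set x | Z (x + (- h))].
  - by exists (y + h); rewrite /= addrK.
  - exact: open_translate.
  by exists (z - h); split=> //=; rewrite subrK.
by apply: GW => i _; exact: Gx.
Qed.

(** Equality with an open set modulo a meager set, phrased by the comeager set [W] on which the two
    agree. *)
Definition baire_property E := exists Z W,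
  [/\ open Z, comeager W & forall x, W x -> (E x <-> Z x)].

Lemma open_baire_property Z : open Z -> baire_property Z.
Proof.
by move=> oO; exists Z, setT; split=> //; apply: comeager_openD; [exact: openT|exact: denseT].
Qed.

(** The complement of [Z] and its interior differ only on the boundary of [Z], which is excluded by
    meeting [W] with the dense open set [Z] together with that interior. *)
Lemma baire_propertyC E : baire_property E -> baire_property (~` E).
Proof.
move=> [Z [W [oO cW EO]]]; exists (~` Z)°, (W `&` (Z `|` (~` Z)°)); split.
- exact: open_interior.
- apply: comeagerI => //; apply: comeager_openD.
    by apply: openU => //; exact: open_interior.
  move=> V [x Vx] oV; have [[y [Vy Oy]]|VO] := pselect (V `&` Z !=set0).
    by exists y; split=> //; left.
  exists x; split=> //; right; rewrite /interior; apply: filterS (open_nbhs_nbhs (conj oV Vx)).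
  by move=> z Vz Oz; apply: VO; exists z.
- move=> x [/EO Ex OOx]; split=> [nEx|Ox /Ex].
    by case: OOx => // Ox; exfalso; apply/nEx/Ex.
  by move/interior_subset: Ox; exact.
Qed.

Lemma baire_property_bigcup (E_ : nat -> set X) : (forall k, baire_property (E_ k)) ->
  baire_property (\bigcup_k E_ k).
Proof.
move=> /choice[Z /choice[W OW]]; exists (\bigcup_k Z k), (\bigcap_k W k); split.
- by apply: bigcup_open => k _; have [] := OW k.
- by apply: comeager_bigcap => k; have [] := OW k.
- by move=> x Wx; split=> -[k _ h]; exists k => //; have [_ _ EO] := OW k;
    apply/EO => //; exact: Wx.
Qed.

Lemma borel_baire_property E : <<s @open X >> E -> baire_property E.
Proof.
apply: smallest_sub; last exact: open_baire_property.
split=> [|A|A]; first by apply: open_baire_property; exact: open0.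
  by rewrite setTD; exact: baire_propertyC.
exact: baire_property_bigcup.
Qed.

(* A category version of the Steinhaus theorem on differences. *)
Lemma baire_steinhaus (U : set X) (E_ : nat -> set X) :
  open U -> U !=set0 -> (forall k, baire_property (E_ k)) -> U `<=` \bigcup_k E_ k ->
  exists k, \forall h \near (0 : X), exists x, [/\ U x, E_ k x & E_ k (x + h)].
Proof.
move=> oU U0 /choice[Z /choice[W OW]] UE.
(* A point of [U] where all the agreements hold at once picks an index k for which [Z k] meets
   [U]. *)
have [] := @comeager_meet (\bigcap_k W k) U => // [|x [Ux Wx]].
  by apply: comeager_bigcap => k; have [] := OW k.
have [k _ Ekx] := UE x Ux; exists k; have [oO cW EO] := OW k.
have Okx : Z k x by apply/EO => //; exact: Wx.
have xc : x + h @[h --> (0 : X)] --> x.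
  by rewrite -[X in _ --> X]addr0; apply: cvgD; [exact: cvg_cst|exact: cvg_id].
have : \forall h \near (0 : X), Z k (x + h).
  by apply: xc; exact: open_nbhs_nbhs.
apply: filterS => h Okh.
(* For small h the open set of z in [U] with z and z + h in [Z k] still contains x, so it contains a
   point where the agreement holds at both z and z + h. *)
have [|||z [[Oz [Ozh Uz]] [Wz Wzh]]] := @comeager_meet (W k `&` [set x | W k (x + h)])
    (Z k `&` ([set x | Z k (x + h)] `&` U)).
- by apply: comeagerI => //; exact: comeager_translate.
- by apply: openI => //; apply: openI => //; exact: open_translate.
- by exists x.
by exists z; split=> //; exact/EO.
Qed.

End BaireProperty.

(** * Normal endomorphisms are contractions *)

Section Endomorphisms.
Context {R : realType} {H : completeNormedModType R[i]}.
Variable dot : {dot H for @conjc R}.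
Hypothesis Hhilbert : hilbert_norm dot.
Variable M : set (H -> H).
Hypothesis MvN : von_neumann_algebra dot M.
Local Notation rdot := (rdot dot).
Local Notation flist := (flist dot).

Lemma flist_le_mass (l : seq (H * H)) A : operator_unit_ball A -> `|flist l A| <= mass l.
Proof.
move=> /rnorm_unit_ball A1; apply: le_trans (ler_norm_sum _ _ _) _.
apply: ler_sum => p _; apply: le_trans (cauchy_schwarz Hhilbert _ _) _.
by rewrite ler_wpM2r ?rnorm_ge0.
Qed.

Lemma predual_bounded rho : predual dot M rho ->
  exists C, forall A, M A -> operator_unit_ball A -> Re (rho A) <= C.
Proof.
move=> rhoM; have [l lE] := predual_approx Hhilbert rhoM ltr01.
exists (1 + mass l) => A MA A1; have := lE A MA A1; have := flist_le_mass l A1.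
by rewrite !ler_norml => /andP[h1 h2] /andP[h3 h4]; lra.
Qed.

Lemma adjoint_comp (A A' B B' : H -> H) : adjoint dot A A' -> adjoint dot B B' ->
  adjoint dot (A \o B) (B' \o A').
Proof. by move=> AA' BB' x y /=; rewrite AA' BB'. Qed.

Lemma adjointC (A A' : H -> H) : adjoint dot A A' -> adjoint dot A' A.
Proof. by move=> AA' x y; rewrite dotC -AA' -dotC. Qed.

Lemma adjoint_unit_ball (A A' : H -> H) : adjoint dot A A' -> operator_unit_ball A ->
  operator_unit_ball A'.
Proof.
move=> AA' /rnorm_unit_ball A1; apply/rnorm_unit_ball => x.
have [->|x0] := eqVneq (rnorm (A' x)) 0; first exact: rnorm_ge0.
have xp : 0 < rnorm (A' x) by rewrite lt_def x0 rnorm_ge0.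
rewrite -(ler_pM2l xp) -expr2 (rnorm_sqr Hhilbert) -(rdot_adjoint _ _ AA').
apply: le_trans (rdot_le Hhilbert _ _) _.
by rewrite ler_wpM2r ?rnorm_ge0.
Qed.

Lemma unit_ball_comp (A B : H -> H) : operator_unit_ball A -> operator_unit_ball B ->
  operator_unit_ball (A \o B).
Proof. by move=> A1 B1 x; exact: le_trans (A1 _) (B1 _). Qed.

(** The excess a j - n at least doubles at each step, since a^2 - n^2 >= 2n(a - n). A positive
    initial excess would make [a] unbounded. *)
Lemma squaring_growth (a : nat -> R) (n C : R) : 0 <= n -> (forall j, 0 <= a j) ->
  (forall j, a j ^+ 2 <= n * a j.+1) -> (forall j, a j ^+ 2 <= C) -> a 0%N <= n.
Proof.
move=> n0 a0 an aC; rewrite leNgt; apply/negP => na.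
have [n_eq0|nN0] := eqVneq n 0.
  by have := an 0%N; rewrite n_eq0 mul0r leNgt exprn_gt0// -n_eq0.
have np : 0 < n by rewrite lt_def nN0.
have step j : 2 * (a j - n) <= a j.+1 - n.
  have : 0 <= n * (a j.+1 - n - 2 * (a j - n)).
    by have := an j; have := sqr_ge0 (a j - n); lra.
  by rewrite pmulr_rge0// subr_ge0.
have grow j : j.+1%:R * (a 0%N - n) <= a j - n.
  elim: j => [|j IH]; first by rewrite mul1r.
  apply: le_trans (step j); have : 0 <= j%:R * (a 0%N - n).
    by rewrite mulr_ge0// subr_ge0 ltW.
  by move: IH; rewrite -!natr1; lra.
have d0 : 0 < a 0%N - n by rewrite subr_gt0.
pose j := Num.trunc ((C + 1) / (a 0%N - n)).
have := grow j; have : (C + 1) < j.+1%:R * (a 0%N - n).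
  by rewrite -ltr_pdivrMr//; exact: truncnS_gt.
by have := aC j; have := sqr_ge0 (a j - 1); have := sqr_ge0 (a j); lra.
Qed.

(* For self-adjoint B the norms of the iterated squares of f B grow doubly
   exponentially as soon as |f B| > 1, whereas the normal functionals
   <f(.) x, x> are bounded on the unit ball. *)
Lemma endomorphism_contraction f : normal_star_endomorphism dot M f ->
  forall A, M A -> operator_unit_ball A -> operator_unit_ball (f A).
Proof.
move=> [fM fL fC fadj frho] A MA A1; apply/rnorm_unit_ball => x.
have [_ adjM _] := MvN; have [A' MA' AA'] := adjM A MA.
(* Iterated squares of the self-adjoint contraction A'A. *)
pose P := fix P j := if j is i.+1 then P i \o P i else A' \o A.
have PP j : [/\ M (P j), operator_unit_ball (P j) & adjoint dot (P j) (P j)].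
  elim: j => [|j [MP P1 Padj]] /=.
    split; [exact: (vn_comp MvN)|apply: unit_ball_comp => //|].
      exact: adjoint_unit_ball AA' A1.
    by apply: adjoint_comp => //; exact: adjointC.
  by split; [exact: (vn_comp MvN)|exact: unit_ball_comp|exact: adjoint_comp].
have fP j y : rnorm (f (P j) y) ^+ 2 = rdot (f (P j.+1) y) y.
  have [MP P1 Padj] := PP j.
  by rewrite (rnorm_sqr Hhilbert) (rdot_adjoint _ _ (fadj _ _ MP MP Padj)) rdotC /= fC.
have [C fPC] := predual_bounded (frho _ (predual_vector dot M x x)).
have fBx : rnorm (f (P 0%N) x) <= rnorm x.
  apply: (@squaring_growth (fun j => rnorm (f (P j) x)) _ C) => [|j|j|j].
  - exact: rnorm_ge0.
  - exact: rnorm_ge0.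
  - by rewrite fP mulrC; exact: rdot_le.
  - by rewrite fP; have [MP P1 _] := PP j.+1; exact: fPC.
(* Back from A'A to A: |f(A)x|^2 is the inner product of f(A'A)x with x. *)
rewrite -ler_sqr ?nnegrE ?rnorm_ge0// (rnorm_sqr Hhilbert).
rewrite (rdot_adjoint _ _ (fadj _ _ MA MA' AA')) rdotC.
have -> : f A' (f A x) = f (P 0%N) x by rewrite /= fC.
apply: le_trans (rdot_le Hhilbert _ _) _.
by rewrite expr2 ler_wpM2r ?rnorm_ge0.
Qed.

End Endomorphisms.

(** * Translations and reflections in normed spaces *)

Section Translations.
Context {R : realType} {X : normedModType R}.

Lemma cvg_subr (x y : X) : z - y @[z --> x] --> x - y.
Proof. by apply: cvgB; [exact: cvg_id|exact: cvg_cst]. Qed.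

Lemma cvg_subl (x y : X) : y - z @[z --> x] --> y - x.
Proof. by apply: cvgB; [exact: cvg_cst|exact: cvg_id]. Qed.

Lemma cvg_scaler (a : R) (x : X) : a *: z @[z --> x] --> a *: x.
Proof. by apply: cvgZl_tmp; exact: cvg_id. Qed.

Lemma near_translate (x : X) (Q : X -> Prop) :
  (\forall h \near (0 : X), Q (x + h)) -> \forall y \near x, Q y.
Proof.
move=> Q0; have : \forall y \near x, Q (x + (y - x)).
  have xc : y - x @[y --> x] --> (0 : X) by rewrite -(subrr x); exact: cvg_subr.
  exact: (xc _ Q0).
by apply: filterS => y; rewrite addrCA subrr addr0.
Qed.

Lemma open_reflect (Z : set X) (t : X) : open Z -> open [set x | Z (t - x)].
Proof.
move=> oZ; apply: (open_comp (f := fun x => t - x)) oZ => x _; exact: cvg_subl.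
Qed.

End Translations.

(** * The cone and its interior *)

Section Cone.
Context {R : realType} {n : nat}.
Variable P : set 'rV[R]_n.
Hypotheses (Pcone : closed_convex_cone P) (Pspan : spanning P).

Lemma cone0 : P 0. Proof. by case: Pcone. Qed.
Lemma coneD x y : P x -> P y -> P (x + y). Proof. by case: Pcone => _ _ h _; exact: h. Qed.
Lemma coneZ a x : 0 <= a -> P x -> P (a *: x). Proof. by case: Pcone => _ _ _; exact. Qed.

(** The interior absorbs the whole cone; this gives meaning to [alpha (y + z)] for y interior and z
    on the boundary. *)
Lemma interior_coneD x y : P° x -> P y -> P° (x + y).
Proof.
move=> Px Py; rewrite /interior.
have := @cvg_subr _ _ (x + y) y; rewrite addrK => xc.
have : nbhs (x + y) [set z | P (z - y)] by exact: xc.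
apply: filterS => z /= Pz.
by rewrite -(subrK y z); exact: coneD.
Qed.

Lemma interior_coneZ (a : R) x : 0 < a -> P° x -> P° (a *: x).
Proof.
move=> a0 Px; rewrite /interior.
have aN0 : a != 0 by rewrite gt_eqF.
have := @cvg_scaler _ _ a^-1 (a *: x); rewrite scalerA mulVf// scale1r => xc.
have : nbhs (a *: x) [set z | P (a^-1 *: z)] by exact: xc.
apply: filterS => z /= Pz.
by rewrite -[z]scale1r -(divff aN0) -scalerA; apply: coneZ => //; exact: ltW.
Qed.

(** Write each basis vector as a i - b i in [P - P]. The sum of all a i + b i is interior: adding v
    with entries below 1 in modulus changes the coefficients to 1 + v i and 1 - v i, still
    nonnegative. *)
Lemma interior_cone_neq0 : P° !=set0.
Proof.
have /choice[a /choice[b ab]] : forall i : 'I_n, exists x y,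
    [/\ P x, P y & delta_mx 0 i = x - y :> 'rV[R]_n] by move=> i; exact: Pspan.
exists (\sum_i (a i + b i)); apply: (near_translate (Q := P)).
apply: filterS (nbhsx_ballx (0 : 'rV[R]_n) 1 ltr01) => v [_ v1].
have -> : \sum_i (a i + b i) + v = \sum_i ((1 + v 0 i) *: a i + (1 - v 0 i) *: b i).
  rewrite [v in LHS]row_sum_delta -big_split/=; apply: eq_bigr => i _.
  have [_ _ ->] := ab i; rewrite !scalerDl !scale1r scalerBr scaleNr.
  by rewrite addrACA.
elim/big_ind : _ => [|x y|i _]; [exact: cone0|exact: coneD|].
have := v1 0 i; rewrite mxE /ball/= sub0r normrN ltr_norml => /andP[v0 v2].
have [Pa Pb _] := ab i.
by apply: coneD; apply: coneZ => //; lra.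
Qed.

End Cone.

(** * Measurability implies continuity on the interior *)

Section Continuity.
Context {R : realType} {n : nat} {H : completeNormedModType R[i]}.
Variable dot : {dot H for @conjc R}.
Hypothesis Hhilbert : hilbert_norm dot.
Variable M : set (H -> H).
Hypothesis MvN : von_neumann_algebra dot M.
Variable P : set 'rV[R]_n.
Hypothesis Pcone : closed_convex_cone P.
Variable alpha : 'rV[R]_n -> (H -> H) -> (H -> H).
Hypothesis alphaE : E_semigroup dot M P° alpha.
Local Notation rdot := (rdot dot).
Local Notation flist := (flist dot).

Lemma semigroup_endo x : P° x -> normal_star_endomorphism dot M (alpha x).
Proof. by case: alphaE => h _; exact: h. Qed.

Lemma semigroup_mem x A : P° x -> M A -> M (alpha x A).
Proof. by move=> /semigroup_endo[h _ _ _ _]; exact: h. Qed.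

Lemma semigroupD x y A : P° x -> P° y -> M A -> alpha x (alpha y A) = alpha (x + y) A.
Proof. by case: alphaE => _ h; exact: h. Qed.

Lemma semigroup_ball x A : P° x -> M A -> operator_unit_ball A ->
  operator_unit_ball (alpha x A).
Proof. by move=> /semigroup_endo h; exact: (endomorphism_contraction Hhilbert MvN h). Qed.

Lemma semigroup_predual x rho : P° x -> predual dot M rho -> predual dot M (rho \o alpha x).
Proof. by move=> /semigroup_endo[_ _ _ _ h]; exact: h. Qed.

Lemma semigroup_lin x a A B : P° x -> M A -> M B ->
  alpha x (a *: A + B) = a *: alpha x A + alpha x B.
Proof. by move=> /semigroup_endo[_ h _ _ _]; exact: h. Qed.

Lemma semigroup0 x : P° x -> alpha x 0 = 0.
Proof.
move=> Px; have M0 := vn_zero MvN; have := semigroup_lin 1 Px M0 M0.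
by rewrite scaler0 addr0 scale1r => h; apply: (addrI (alpha x 0)); rewrite addr0 -h.
Qed.

Lemma semigroupZ x a A : P° x -> M A -> alpha x (a *: A) = a *: alpha x A.
Proof.
by move=> Px MA; have := semigroup_lin a Px MA (vn_zero MvN); rewrite semigroup0// !addr0.
Qed.

Lemma vn_unit_ball_scale A : M A ->
  exists2 K : R, 0 < K & operator_unit_ball (K^-1%:C *: A) /\ A = K%:C *: (K^-1%:C *: A).
Proof.
move=> MA; have /bounded_operatorP[_ [K K0 AK]] := vn_bounded MvN MA.
have K1 : 0 < K + 1 by rewrite ltr_wpDl.
exists (K + 1) => //; split.
  apply/rnorm_unit_ball => x; rewrite fctE rnormZ gtr0_norm ?invr_gt0// ler_pdivrMl//.
  by apply: le_trans (AK x) _; rewrite ler_wpM2r ?rnorm_ge0// lerDl.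
by rewrite scalerA -rmorphM/= divff ?gt_eqF// scale1r.
Qed.

Hypothesis Msep : separable_predual dot M.
Hypothesis alpha_meas : sigma_weakly_measurable dot M P° alpha.

Lemma separable_predual_seq : exists d : nat -> (H -> H) -> R[i]^o,
  forall rho, predual dot M rho -> forall e : R, 0 < e ->
    exists k, forall A, M A -> operator_unit_ball A -> `|rho A - d k A| <= e%:C.
Proof.
have [D [/pfcard_geP[D0|[d]] _ DE]] := Msep.
  have [rho' D' _] := DE _ (predual_vector dot M 0 0) 1 ltr01.
  by move: D'; rewrite D0.
exists d => rho rhoM e e0; have [rho' Drho' rhoE] := DE _ rhoM e e0.
have [k _ dk] := @surj _ _ _ _ d _ Drho'; exists k => A MA A1.
by rewrite dk; exact: rhoE.
Qed.

(** The order on complex numbers is partial; both sides are real, hence comparable. *)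
Lemma ler_normCP (z : R[i]) (e : R) : `|z| <= e%:C <-> ~ (e%:C < `|z|).
Proof.
by rewrite real_leNgt ?normr_real ?complex_real//; split=> /negP.
Qed.

Lemma orbit_norm_continuous rho t (e : R) : predual dot M rho -> P° t -> 0 < e ->
  \forall h \near (0 : 'rV[R]_n), forall A, M A -> operator_unit_ball A ->
    `|rho (alpha (t + h) A) - rho (alpha t A)| <= e%:C.
Proof.
move=> rhoM Pt e0; have e8 : 0 < e / 8 by rewrite divr_gt0.
have [d dE] := separable_predual_seq.
(* [T (i, j)] witnesses that [d i] and [d j] are more than 3e/8 apart on the unit ball, if they are.
   These countably many tests replace the supremum over the ball. *)
have /choice[T TP] : forall ij : nat * nat, exists A, [/\ M A, operator_unit_ball A &
    (exists A, [/\ M A, operator_unit_ball A & (3 * (e / 8))%:C < `|d ij.1 A - d ij.2 A|]) ->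
    (3 * (e / 8))%:C < `|d ij.1 A - d ij.2 A| ].
  move=> ij; have [[A [MA A1 dA]]|nA] := pselect (exists A, [/\ M A, operator_unit_ball A &
    (3 * (e / 8))%:C < `|d ij.1 A - d ij.2 A|]); first by exists A.
  by exists 0; split=> //; [exact: (vn_zero MvN)|move=> x; rewrite normr0].
(* Countably many weakly measurable conditions, so [E k] is Borel. They still control the norm: some
   [d i] is within e/8 of the orbit at x, so the test (i, k) keeps [d i] within 3e/8 of [d k], and
   e/8 + 3e/8 = e/2. *)
pose E k := [set x | P° x /\ forall i j,
  `|rho (alpha x (T (i, j))) - d k (T (i, j))| < (2 * (e / 8))%:C].
have close k x : E k x -> forall A, M A -> operator_unit_ball A ->
    `|rho (alpha x A) - d k A| <= (e / 2)%:C.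
  move=> [Px Ekx] A MA A1; have [i iE] := dE _ (semigroup_predual Px rhoM) _ e8.
  have [MT T1 Tmax] := TP (i, k).
  have dT : `|d i (T (i, k)) - d k (T (i, k))| <= (3 * (e / 8))%:C.
    rewrite -(subrKA (rho (alpha x (T (i, k))))) (le_trans (ler_normD _ _))//.
    rewrite (_ : 3 * _ = e / 8 + 2 * (e / 8)); last by ring.
    by rewrite rmorphD lerD// ?(ltW (Ekx _ _))// distrC; exact: iE.
  have dA : `|d i A - d k A| <= (3 * (e / 8))%:C.
    apply/ler_normCP => h; move/ler_normCP : dT; apply; apply: Tmax.
    by exists A.
  rewrite -(subrKA (d i A)) (le_trans (ler_normD _ _))//.
  by rewrite (_ : e / 2 = e / 8 + 3 * (e / 8)) ?rmorphD ?lerD ?iE//; field.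
have bpE k : baire_property (E k).
  apply: borel_baire_property.
  have -> : E k = \bigcap_i \bigcap_j (P° `&` (fun x => rho (alpha x (T (i, j)))) @^-1`
      ball (d k (T (i, j)) : R[i]^o) (2 * (e / 8))%:C).
    apply/seteqP; split=> [x [Px Ex] i _ j _|x Ex].
      by split=> //; rewrite /= -ball_normE/= distrC.
    have [Px _] := Ex 0%N Logic.I 0%N Logic.I; split=> // i j.
    by have [_] := Ex i Logic.I j Logic.I; rewrite /= -ball_normE/= distrC.
  pose T' := g_sigma_algebraType (@open 'rV[R]_n).
  apply: (@bigcapT_measurable _ T') => i; apply: (@bigcapT_measurable _ T') => j.
  have [MT _ _] := TP (i, j).
  apply: (alpha_meas rhoM MT); first by apply: sub_sigma_algebra; exact: open_interior.
  by apply: sub_sigma_algebra; apply: ball_open; rewrite ltcR mulr_gt0.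
(* On this open set, which contains t/2, both x and t - x are interior. *)
have [||||k] := @baire_steinhaus _ _ (P° `&` [set x | P° (t - x)]) E => //.
- apply: openI; first exact: open_interior.
  exact: open_reflect (@open_interior _ P).
- exists (2^-1 *: t); split; first exact: interior_coneZ.
  rewrite /= -[X in X - _]scale1r -scalerBl; apply: interior_coneZ => //.
  by rewrite subr_gt0 invf_lt1// ltr1n.
- move=> x [Px _]; have [k kE] := dE _ (semigroup_predual Px rhoM) _ e8.
  exists k => //; split=> // i j; have [MT T1 _] := TP (i, j).
  by apply: le_lt_trans (kE _ MT T1) _; rewrite ltcR; lra.
apply: filterS => h [x [[Px Ptx] Ex Exh]] A MA A1.
have [Pxh _] := Exh.
(* The common summand t - x moves the estimate from x, x + h to t, t + h: [alpha (t - x) A] is again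
   in the unit ball. *)
have -> : t + h = (x + h) + (t - x) by rewrite [RHS]addrC addrA subrK.
have tE : t = x + (t - x) by rewrite addrCA subrr addr0.
rewrite [in X in _ - X]tE -(semigroupD Pxh Ptx MA) -(semigroupD Px Ptx MA).
have MB := semigroup_mem Ptx MA; have B1 := semigroup_ball Ptx MA A1.
rewrite -(subrKA (d k (alpha (t - x) A))) (le_trans (ler_normD _ _))//.
rewrite [e in leRHS]splitr rmorphD lerD ?close//.
by rewrite distrC close.
Qed.

Theorem semigroup_continuous : sigma_weakly_continuous dot M P° alpha.
Proof.
move=> rho A rhoM MA; rewrite continuous_open_subspace; last exact: open_interior.
move=> t /set_mem Pt; have [K K0 [B1 AE]] := vn_unit_ball_scale MA.
set B := _ *: A in B1 AE; have MB : M B by exact: (vn_scale MvN).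
clearbody B.
apply/(@cvgrPdist_le _ _ _ (nbhs t) _) => _ /gtc0P[e e0 ->].
have eK : 0 < e / K by rewrite divr_gt0.
have Pnear : \forall y \near t, P° y.
  by apply: open_nbhs_nbhs; split=> //; exact: open_interior.
have := near_translate (Q := fun y => forall A, M A -> operator_unit_ball A ->
  `|rho (alpha y A) - rho (alpha t A)| <= (e / K)%:C) (orbit_norm_continuous rhoM Pt eK).
apply: filterS2 Pnear => y Py /(_ B MB B1).
rewrite AE !semigroupZ// !(predualZ MvN) //; try exact: semigroup_mem.
rewrite -mulrBr normrM normc_real (gtr0_norm K0) distrC => h.
apply: le_trans (ler_wpM2l _ h) _; first by rewrite ler0c ltW.
by rewrite -rmorphM lecR mulrC divfK ?gt_eqF.
Qed.

End Continuity.

Lemma cvg_geometric_scale {R : realType} {X : normedModType R} (x : X) :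
  (2^-1 ^+ k : R) *: x @[k --> \oo] --> (0 : X).
Proof.
rewrite -[X in _ --> X](scale0r x); apply: (@cvgZ _ _ _ _ _ _ (fun=> x)); last exact: cvg_cst.
by apply: cvg_expr; rewrite ger0_norm// invf_lt1// ltr1n.
Qed.

(** * Density of orbit functionals and weak limits at points of the cone *)

Section Extension.
Context {R : realType} {n : nat} {H : completeNormedModType R[i]}.
Variable dot : {dot H for @conjc R}.
Hypothesis Hhilbert : hilbert_norm dot.
Variable M : set (H -> H).
Hypothesis MvN : von_neumann_algebra dot M.
Variable P : set 'rV[R]_n.
Hypotheses (Pcone : closed_convex_cone P) (Pspan : spanning P).
Variable alpha : 'rV[R]_n -> (H -> H) -> (H -> H).
Hypothesis alphaE : E_semigroup dot M P° alpha.
Hypothesis alpha_cont : sigma_weakly_continuous dot M P° alpha.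
Hypothesis alpha_faithful : faithful M P° alpha.
Local Notation rdot := (rdot dot).
Local Notation flist := (flist dot).
Local Notation interior_point := {y : 'rV[R]_n | P° y}.
Implicit Types (L : seq (interior_point * (H * H))).

(** Finite sums of vector functionals precomposed with [alpha y]. Each entry carries the proof that
    its y is interior. *)
Definition orbit_list L (A : H -> H) : R[i]^o :=
  \sum_(p <- L) dot (alpha (sval p.1) A p.2.1) p.2.2.

Lemma orbit_list_cat L L' A : orbit_list (L ++ L') A = orbit_list L A + orbit_list L' A.
Proof. by rewrite /orbit_list big_cat. Qed.

Definition scale_orbit_list (t : R) L : seq (interior_point * (H * H)) :=
  [seq (p.1, (p.2.1, t%:C *: p.2.2)) | p <- L].

Lemma orbit_list_scale t L A : orbit_list (scale_orbit_list t L) A = t%:C * orbit_list L A.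
Proof.
rewrite /orbit_list /scale_orbit_list big_map mulr_sumr.
by apply: eq_bigr => p _; rewrite dotZr conjc_real.
Qed.

Lemma orbit_listZ L a A : M A -> orbit_list L (a *: A) = a * orbit_list L A.
Proof.
move=> MA; rewrite /orbit_list mulr_sumr; apply: eq_bigr => p _.
by rewrite (semigroupZ MvN alphaE _ (svalP p.1) MA) fctE dotZl.
Qed.

Lemma orbit_list0 L : orbit_list L 0 = 0.
Proof. by have := orbit_listZ L 0 (vn_zero MvN); rewrite scale0r mul0r. Qed.

Lemma unit_ball_scale (a : R[i]) (A : H -> H) : `|a| = 1 -> operator_unit_ball A ->
  operator_unit_ball (a *: A).
Proof. by move=> a1 A1 x; rewrite fctE normrZ a1 mul1r. Qed.

Lemma unit_ball0 : operator_unit_ball (0 : H -> H).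
Proof. by move=> x; rewrite [leLHS](_ : _ = 0)//; exact: normr0. Qed.

(* By Hahn-Banach, faithfulness makes the functionals rho o alpha_y norm dense
   in the predual. *)
Lemma flist_orbit_approx (l : seq (H * H)) (e : R) : 0 < e ->
  exists L, forall A, M A -> operator_unit_ball A ->
    `|flist l A - Re (orbit_list L A)| <= e.
Proof.
move=> e0.
(* [q] below is the distance to the orbit functionals on the unit ball of [M]. One-sided bounds
   suffice, as the ball is stable under negation. *)
pose E g := [set c : R | exists L, forall A, M A -> operator_unit_ball A ->
  g A - Re (orbit_list L A) <= c].
pose q (g : (H -> H) -> R^o) := inf (E g).
have F0 g : finite_functional dot g -> g 0 = 0.
  by move=> [l' _ <-]; rewrite /flist big1// => p _; exact: rdot0l.
have Elb g : finite_functional dot g -> lbound (E g) 0.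
  move=> Fg c [L Lc]; apply: le_trans (Lc 0 (vn_zero MvN) unit_ball0).
  by rewrite F0// orbit_list0 subrr.
have q_le g c L : finite_functional dot g -> (forall A, M A -> operator_unit_ball A ->
    g A - Re (orbit_list L A) <= c) -> q g <= c.
  by move=> Fg gc; apply: ge_inf; [exists 0; exact: Elb|exists L].
have E_nonempty g : finite_functional dot g -> E g !=set0.
  move=> [l' _ <-]; exists (mass l'), [::] => A MA A1.
  rewrite /orbit_list big_nil subr0; apply: le_trans (ler_norm _) _.
  exact: flist_le_mass.
have q_ge g m : finite_functional dot g -> (forall c, E g c -> m <= c) -> m <= q g.
  by move=> Fg h; apply: lb_le_inf; [exact: E_nonempty|move=> c /h].
have q0 g : finite_functional dot g -> (forall A, M A -> g A = 0) -> q g <= 0.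
  move=> Fg g0; apply: (q_le g 0 [::] Fg) => A MA A1.
  by rewrite g0// /orbit_list big_nil subrr.
have qS : sublinear_on (finite_functional dot) q.
  apply: sublinear_onI => [|g g' Fg Fg'|_|t g t0 Fg].
  - exact: finite_functionalZ.
  - rewrite -lerBlDr; apply: (q_ge _ _ Fg) => c [L Lc].
    rewrite lerBlDr [leRHS]addrC -lerBlDr; apply: (q_ge _ _ Fg') => c' [L' Lc'].
    rewrite lerBlDr; apply: (q_le _ _ (L ++ L')); first exact: finite_functionalD.
    move=> A MA A1; rewrite orbit_list_cat ReD fctE.
    by have := Lc A MA A1; have := Lc' A MA A1; lra.
  - have F0' : finite_functional dot 0.
      by exists [::] => //; apply/funext => A; rewrite /flist big_nil.
    apply/eqP; rewrite eq_le q0//=; apply: (q_ge _ _ F0') => c; exact: Elb.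
  - rewrite -ler_pdivrMl//; apply: (q_ge _ _ Fg) => c [L Lc]; rewrite ler_pdivrMl//.
    apply: (q_le _ _ (scale_orbit_list t L)); first exact: finite_functionalZ.
    move=> A MA A1; rewrite orbit_list_scale ReZ fctE -[_ *: _]/(_ * _) -mulrBr.
    by rewrite ler_wpM2l ?(ltW t0)//; exact: Lc.
have Fl l' : finite_functional dot (flist l') by exists l'.
have [|A [MA A1 Aq Al]] := @sublinear_attained _ _ _ Hhilbert _ MvN q l qS _ q0.
  move=> x y; apply: (q_le _ _ [::]) => // B MB B1.
  rewrite /orbit_list big_nil subr0 flist1; apply: le_trans (rdot_le Hhilbert _ _) _.
  by rewrite ler_wpM2r ?rnorm_ge0//; move/rnorm_unit_ball : B1.
(* [A] attains the distance and is dominated by [q], which vanishes on orbit functionals up to an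
   error: they are not finite, so each is first replaced by a finite functional within d/2. Hence
   all [alpha y A] vanish, and faithfulness applies. *)
have A0 : A = 0.
  apply: alpha_faithful => // y Py; apply/funext => x; apply: (rdot_inj (dot := dot)) => z.
  suff h w : rdot (alpha y A x) w <= 0.
    rewrite [RHS]rdot0l; apply/eqP; rewrite eq_le h/=.
    by have := h (- z); rewrite rdotNr oppr_le0.
  apply/ler_addgt0Pr => d d0; rewrite add0r.
  have rhoM := semigroup_predual alphaE Py (predual_vector dot M x w).
  have d2 : 0 < d / 2 by rewrite divr_gt0.
  have [l' l'E] := predual_approx Hhilbert rhoM d2.
  have := l'E A MA A1; rewrite /= ler_norml => /andP[_ h].
  have ql' : q (flist l') <= d / 2.
    apply: (q_le _ _ [:: (exist _ y Py, (x, w))]) => // B MB B1.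
    have := l'E B MB B1; rewrite /= ler_norml => /andP[h' _].
    by rewrite /orbit_list big_seq1/=; lra.
  have := le_trans (Aq _ (Fl l')) ql'; rewrite -[rdot _ _]/(Re (dot (alpha y A x) w)); lra.
have qe : q (flist l) < e by rewrite -Al A0 F0.
have [c [L Lc] ce] := inf_lt (E_nonempty _ (Fl l)) qe.
exists L => B MB B1; rewrite ler_norml; apply/andP; split; last first.
  by apply: le_trans (Lc B MB B1) _; exact: ltW.
have N1 : `|-1 : R[i]| = 1 by rewrite normrN1.
have := Lc _ (vn_scale MvN (-1) MB) (unit_ball_scale N1 B1).
rewrite orbit_listZ// mulN1r ReN.
have -> : flist l (-1 *: B) = - flist l B.
  by rewrite /flist -sumrN; apply: eq_bigr => p _; rewrite fctE scaleN1r rdotNl.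
by move: ce; lra.
Qed.

(** Two errors e/4 bound the real part of the difference by e/2, and replacing A by iA does the same
    for the imaginary part. *)
Lemma orbit_functionals_dense rho (e : R) : predual dot M rho -> 0 < e ->
  exists L, forall A, M A -> operator_unit_ball A ->
    `|rho A - orbit_list L A| <= e%:C.
Proof.
move=> rhoM e0; have e4 : 0 < e / 4 by rewrite divr_gt0.
have [l lE] := predual_approx Hhilbert rhoM e4.
have [L LE] := flist_orbit_approx l e4.
have Re_le A : M A -> operator_unit_ball A -> `|Re (rho A - orbit_list L A)| <= e / 2.
  move=> MA A1; rewrite ReB -(subrKA (flist l A)) (le_trans (ler_normD _ _))//.
  by have := lE A MA A1; have := LE A MA A1; lra.
exists L => A MA A1; apply: le_trans (normc_le_ReIm _) _.
rewrite lecR [leRHS]splitr lerD ?Re_le//.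
have i1 : `|'i : R[i]| = 1.
  by rewrite normc_def/= expr0n expr1n add0r sqrtr1.
have := Re_le _ (vn_scale MvN 'i MA) (unit_ball_scale i1 A1).
by rewrite orbit_listZ// (predualZ MvN)// -mulrBr mulrC ReiNIm normrN.
Qed.

Lemma semigroup_cvg rho A t {T : Type} {F : set_system T} {FF : Filter F} (f : T -> 'rV[R]_n) :
  predual dot M rho -> M A -> P° t -> f x @[x --> F] --> t ->
  rho (alpha (f x) A) @[x --> F] --> rho (alpha t A).
Proof.
move=> rhoM MA Pt ft; have := alpha_cont rhoM MA.
rewrite continuous_open_subspace; last exact: open_interior.
move=> /(_ t (mem_set Pt)) h; exact: cvg_comp ft h.
Qed.

Lemma is_cvgn_uniform_approx (u : nat -> R) :
  (forall e : R, 0 < e -> exists2 w : nat -> R, cvgn w & forall k, `|u k - w k| <= e) ->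
  cvgn u.
Proof.
move=> uw; apply: cauchy_cvg; apply: cauchy_exP => e e0.
have e4 : 0 < e / 4 by rewrite divr_gt0.
have [w /cvgn_dist/(_ _ e4)[N Ne] uwE] := uw _ e4.
exists (limn w); exists N => // k /= Nk; rewrite -ball_normE/=.
have := Ne k Nk; have := uwE k; rewrite !ler_norml ltr_norml => /andP[h1 h2] /andP[h3 h4].
by apply/andP; split; lra.
Qed.

Lemma cvgn_eq_approx (u v : nat -> R) a b : u k @[k --> \oo] --> a ->
  v k @[k --> \oo] --> b -> forall e, (forall k, `|u k - v k| <= e) -> `|a - b| <= e.
Proof.
move=> ua vb e uv; rewrite -[a - b]subr0.
apply: (@cvg_normr_le _ (fun k => u k - v k) _ _ _ 0%N) => [|k _].
  exact: cvgB.
by rewrite subr0.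
Qed.

(** Each y in [L] shifts the limit point z to y + z, which is interior, where continuity is
    known. *)
Lemma orbit_list_cvg L z A (x_ : nat -> 'rV[R]_n) : P z -> M A ->
  (forall k, P° (x_ k)) -> x_ k @[k --> \oo] --> (0 : 'rV[R]_n) ->
  orbit_list L (alpha (z + x_ k) A) @[k --> \oo] -->
  (\sum_(p <- L) dot (alpha (sval p.1 + z) A p.2.1) p.2.2 : R[i]^o).
Proof.
move=> Pz MA Px x0; rewrite /orbit_list.
elim: L => [|p L IH].
  by rewrite big_nil; apply: cvg_near_cst; apply: nearW => k; rewrite big_nil.
rewrite big_cons; under eq_fun do rewrite big_cons.
apply: cvgD IH.
have Py := svalP p.1; set y := sval p.1 in Py *.
have Pzx k : P° (z + x_ k) by rewrite addrC; exact: interior_coneD.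
under eq_fun do rewrite (semigroupD alphaE Py (Pzx _) MA).
apply: (semigroup_cvg (predual_vector dot M p.2.1 p.2.2) MA) => //.
  exact: interior_coneD.
rewrite -[X in _ --> X]addr0; under eq_fun do rewrite addrA.
by apply: cvgD => //; exact: cvg_cst.
Qed.

Lemma null_sequence : exists x_ : nat -> 'rV[R]_n,
  (forall k, P° (x_ k)) /\ x_ k @[k --> \oo] --> (0 : 'rV[R]_n).
Proof.
have [x Px] := interior_cone_neq0 Pcone Pspan.
exists (fun k => (2^-1 ^+ k : R) *: x); split=> [k|].
  by apply: interior_coneZ => //; rewrite exprn_gt0.
exact: cvg_geometric_scale.
Qed.

(** Matrix coefficients of [alpha (z + x_ k) A] are uniform limits of convergent sequences by
    density, so they converge; the limit form inherits its bound and its compatibility with the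
    commutant. *)
Lemma extension_ball z A : P z -> M A -> operator_unit_ball A ->
  exists B, [/\ M B, operator_unit_ball B &
    forall y, P° y -> alpha y B = alpha (y + z) A].
Proof.
move=> Pz MA A1; have [x_ [Px x0]] := null_sequence.
have Pzx k : P° (z + x_ k) by rewrite addrC; exact: interior_coneD.
pose A_ k := alpha (z + x_ k) A.
have MA_ k : M (A_ k) by exact: (semigroup_mem alphaE).
have A1_ k : operator_unit_ball (A_ k) by exact: (semigroup_ball Hhilbert MvN alphaE).
pose v x y k := rdot (A_ k x) y.
have v_cvg x y : cvgn (v x y).
  apply: is_cvgn_uniform_approx => e e0.
  have [L LE] := flist_orbit_approx [:: (x, y)] e0.
  exists (fun k => Re (orbit_list L (A_ k))).
    apply/cvg_ex; eexists.
    by have /cvg_complexP[h _] := orbit_list_cvg (L := L) Pz MA Px x0; exact: h.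
  by move=> k; have := LE _ (MA_ k) (A1_ k); rewrite flist1.
pose b x y := limn (v x y).
have bE x y (l : R) : v x y k @[k --> \oo] --> l -> b x y = l.
  by move=> h; apply: cvg_lim h.
have A_b k := vn_bounded MvN (MA_ k).
have [||||||B [MB bB B1]] := @vn_bilinear _ _ _ Hhilbert _ MvN b 1 ler01.
- move=> x y w; apply: bE; rewrite (_ : v _ _ = v x w + v y w); last first.
    by apply/funext => k; rewrite /v (bounded_operatorD _ _ (A_b k)) rdotDl.
  by apply: cvgD; exact: v_cvg.
- move=> x y w; apply: bE; rewrite (_ : v _ _ = v x y + v x w); last first.
    by apply/funext => k; rewrite /v rdotDr.
  by apply: cvgD; exact: v_cvg.
- move=> t x y; apply: bE; rewrite (_ : v _ _ = (fun k => t * v x y k)); last first.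
    by apply/funext => k; rewrite /v (bounded_operatorZ _ _ (A_b k)) rdotZl.
  by apply: cvgM; [exact: cvg_cst|exact: v_cvg].
- move=> t x y; apply: bE; rewrite (_ : v _ _ = (fun k => t * v x y k)); last first.
    by apply/funext => k; rewrite /v rdotZr.
  by apply: cvgM; [exact: cvg_cst|exact: v_cvg].
- move=> x y; rewrite mul1r -[b x y]subr0.
  apply: (@cvg_normr_le _ (v x y) _ _ _ 0%N) => [|k _]; first exact: v_cvg.
  rewrite subr0; apply: le_trans (cauchy_schwarz Hhilbert _ _) _.
  by rewrite ler_wpM2r ?rnorm_ge0//; move/rnorm_unit_ball : (A1_ k).
- move=> C C' [_ CM] CC' x y; rewrite /b (_ : v _ _ = v x (C' y))//.
  apply/funext => k; rewrite /v -(rdot_adjoint _ _ CC').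
  by have /(congr1 (@^~ x)) /= -> := CM _ (MA_ k).
have B1' : operator_unit_ball B.
  by apply/rnorm_unit_ball => x; rewrite -[leRHS]mul1r.
exists B; split=> // y Py; apply/funext => x; apply: (rdot_inj (dot := dot)) => w.
(* Normality of [alpha y] lets it pass to the weak limit: on the unit ball the functional is close
   to a finite one, whose values at [A_ k] converge to its value at [B]. *)
have rhoM := semigroup_predual alphaE Py (predual_vector dot M x w).
apply/eqP; rewrite -subr_eq0 -normr_le0; apply/ler_addgt0Pr => e e0; rewrite add0r.
have e2 : 0 < e / 2 by rewrite divr_gt0.
have [l lE] := predual_approx Hhilbert rhoM e2.
have lB := lE _ MB B1'.
have l_cvg : flist l (A_ k) @[k --> \oo] --> flist l B.
  rewrite /flist; elim: (l) => [|p l' IH].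
    by rewrite big_nil; apply: cvg_near_cst; apply: nearW => k; rewrite big_nil.
  rewrite big_cons; under eq_fun do rewrite big_cons.
  apply: cvgD IH; rewrite -bB; exact: v_cvg.
have a_cvg : rdot (alpha y (A_ k) x) w @[k --> \oo] --> rdot (alpha (y + z) A x) w.
  have := orbit_list_cvg (L := [:: (exist _ y Py, (x, w))]) Pz MA Px x0.
  rewrite /orbit_list big_seq1; under eq_fun do rewrite big_seq1.
  by move=> /cvg_complexP[].
have h := cvgn_eq_approx a_cvg l_cvg (e := e / 2) (fun k => lE _ (MA_ k) (A1_ k)).
rewrite -(subrKA (flist l B)) [leRHS]splitr (le_trans (ler_normD _ _))// lerD//.
by rewrite distrC.
Qed.

Lemma faithful_inj A B : M A -> M B -> (forall y, P° y -> alpha y A = alpha y B) -> A = B.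
Proof.
move=> MA MB AB; apply/eqP; rewrite -subr_eq0; apply/eqP.
apply: alpha_faithful => [|y Py]; first exact: (vn_sub MvN).
by rewrite addrC -scaleN1r (semigroup_lin alphaE)// AB// scaleN1r addNr.
Qed.

End Extension.

(** * The extended semigroup on the whole cone *)

Section ExtendedSemigroup.
Context {R : realType} {n : nat} {H : completeNormedModType R[i]}.
Variable dot : {dot H for @conjc R}.
Hypothesis Hhilbert : hilbert_norm dot.
Variable M : set (H -> H).
Hypothesis MvN : von_neumann_algebra dot M.
Variable P : set 'rV[R]_n.
Hypotheses (Pcone : closed_convex_cone P) (Pspan : spanning P).
Variable alpha : 'rV[R]_n -> (H -> H) -> (H -> H).
Hypothesis alphaE : E_semigroup dot M P° alpha.
Hypothesis alpha_cont : sigma_weakly_continuous dot M P° alpha.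
Hypothesis alpha_faithful : faithful M P° alpha.

Definition is_extension z A B :=
  M B /\ forall y, P° y -> alpha y B = alpha (y + z) A.

(** The choice is harmless, the element being unique; the default 0 is not reached for z in [P] and
    A in [M]. *)
Definition extension z A : H -> H := xget 0 [set B | is_extension z A B].

Let inj := faithful_inj MvN alphaE alpha_faithful.

Lemma is_extension_unique z A B B' : is_extension z A B -> is_extension z A B' -> B = B'.
Proof. by move=> [MB BE] [MB' BE']; apply: inj => // y Py; rewrite BE// BE'. Qed.

(** Main tool of this part: an identity for [extension z] is checked after applying [alpha y] for
    interior y, where it becomes one for [alpha (y + z)]. *)
Lemma extensionE z A B : is_extension z A B -> extension z A = B.
Proof.
move=> AB; apply: (@is_extension_unique z A) => //.
exact: (@xgetPex _ 0 [set B | is_extension z A B]) (ex_intro _ B AB).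
Qed.

Lemma extensionP z A : P z -> M A -> is_extension z A (extension z A).
Proof.
move=> Pz MA; have [K K0 [A1 AE]] := vn_unit_ball_scale MvN MA.
set A' := _ *: A in A1 AE; have MA' : M A' by exact: (vn_scale MvN).
clearbody A'.
have [B [MB _ BE]] := extension_ball Hhilbert MvN Pcone Pspan alphaE alpha_cont
  alpha_faithful Pz MA' A1.
suff AB : is_extension z A (K%:C *: B) by rewrite (extensionE AB).
split=> [|y Py]; first exact: (vn_scale MvN).
rewrite AE (semigroupZ MvN alphaE)// BE// (semigroupZ MvN alphaE)//.
exact: interior_coneD.
Qed.

Lemma extension_mem z A : P z -> M A -> M (extension z A).
Proof. by move=> Pz MA; have [] := extensionP Pz MA. Qed.

Lemma extension_semigroup y z A : P° y -> P z -> M A ->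
  alpha y (extension z A) = alpha (y + z) A.
Proof. by move=> Py Pz MA; have [_] := extensionP Pz MA; exact. Qed.

Lemma extension_unit_ball z A : P z -> M A -> operator_unit_ball A ->
  operator_unit_ball (extension z A).
Proof.
move=> Pz MA A1; have [B [MB B1 BE]] := extension_ball Hhilbert MvN Pcone Pspan alphaE
  alpha_cont alpha_faithful Pz MA A1.
by rewrite (@extensionE z A B).
Qed.

Lemma extension_interior z A : P° z -> M A -> extension z A = alpha z A.
Proof.
move=> Pz MA; apply: extensionE; split=> [|y Py]; first exact: (semigroup_mem alphaE).
exact: (semigroupD alphaE).
Qed.

Lemma extension_lin z a A B : P z -> M A -> M B ->
  extension z (a *: A + B) = a *: extension z A + extension z B.
Proof.
move=> Pz MA MB; have MA' := extension_mem Pz MA; have MB' := extension_mem Pz MB.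
apply: extensionE; split=> [|y Py]; first exact: (vn_lin MvN).
have Pyz := interior_coneD Pcone Py Pz.
by rewrite !(semigroup_lin alphaE)// !extension_semigroup.
Qed.

Lemma extension_orbit_list (L : seq ({y : 'rV[R]_n | P° y} * (H * H))) z A : P z -> M A ->
  orbit_list dot alpha L (extension z A) =
  \sum_(p <- L) dot (alpha (sval p.1 + z) A p.2.1) p.2.2.
Proof.
move=> Pz MA; apply: eq_bigr => p _.
by rewrite (extension_semigroup (svalP p.1) Pz MA).
Qed.

Lemma extensionZ z a A : P z -> M A -> extension z (a *: A) = a *: extension z A.
Proof.
move=> Pz MA; apply: extensionE; split=> [|y Py].
  by apply: (vn_scale MvN); exact: extension_mem.
have Pyz := interior_coneD Pcone Py Pz.
have MA' := extension_mem Pz MA.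
by rewrite !(semigroupZ MvN alphaE)// extension_semigroup.
Qed.

(** Approximate [rho] by an orbit functional; composed with [extension z] it involves only
    [alpha (y + z)] at interior points, which is normal. Contractivity of the extension keeps the
    error uniform. *)
Lemma extension_predual z rho : P z -> predual dot M rho ->
  predual dot M (rho \o extension z).
Proof.
move=> Pz rhoM; apply: (predual_closed Hhilbert MvN) => [a A MA|e e0].
  by rewrite /= extensionZ// (predualZ MvN)//; exact: extension_mem.
have e2 : 0 < e / 2 by rewrite divr_gt0.
have [L LE] := orbit_functionals_dense Hhilbert MvN alphaE alpha_faithful rhoM e2.
have [l lE] : exists l, forall A, M A -> operator_unit_ball A ->
    `|Re (orbit_list dot alpha L (extension z A)) - flist dot l A| <= e / 2.
  suff : forall d, 0 < d -> exists l, forall A, M A -> operator_unit_ball A ->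
    `|Re (orbit_list dot alpha L (extension z A)) - flist dot l A| <= d by exact.
  elim: L {LE} => [|p L IH] d d0.
    exists [::] => A MA A1; rewrite /orbit_list /flist !big_nil subrr normr0.
    exact: ltW.
  have d2 : 0 < d / 2 by rewrite divr_gt0.
  have [l lE] := IH _ d2.
  have Pyz := interior_coneD Pcone (svalP p.1) Pz.
  have [l' l'E] := predual_approx Hhilbert
    (semigroup_predual alphaE Pyz (predual_vector dot M p.2.1 p.2.2)) d2.
  exists (l' ++ l) => A MA A1; have := l'E A MA A1; have := lE A MA A1.
  rewrite flist_cat fctE !extension_orbit_list// big_cons ReD /= => h1 h2.
  by rewrite opprD addrACA (le_trans (ler_normD _ _))// [leRHS]splitr lerD.
exists l => A MA A1; have MB := extension_mem Pz MA.
have B1 := extension_unit_ball Pz MA A1.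
rewrite -(subrKA (Re (orbit_list dot alpha L (extension z A)))).
rewrite (le_trans (ler_normD _ _))// [leRHS]splitr lerD ?lE//.
by rewrite -ReB -lecR (le_trans (normc_ge_Re _))// LE.
Qed.

Lemma extension_endomorphism z : P z -> normal_star_endomorphism dot M (extension z).
Proof.
move=> Pz; have Py' y : P° y -> P° (y + z) by move=> Py; exact: interior_coneD.
split=> [A MA|a A B MA MB|A B MA MB|A B MA MB AB|rho].
- exact: extension_mem.
- exact: extension_lin.
- have MA' := extension_mem Pz MA; have MB' := extension_mem Pz MB.
  apply: extensionE; split=> [|y Py]; first exact: (vn_comp MvN).
  have [_ _ hC _ _] := semigroup_endo alphaE Py.
  have [_ _ hC' _ _] := semigroup_endo alphaE (Py' _ Py).
  by rewrite hC// hC'// !extension_semigroup.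
- have MA' := extension_mem Pz MA; have MB' := extension_mem Pz MB.
  have [_ adjM _] := MvN; have [C MC AC] := adjM _ MA'.
  (* [C] is the adjoint of [extension z A] in [M]. Both [alpha y C] and [alpha (y + z) B] are
     adjoint to [alpha (y + z) A], so they coincide. *)
  suff -> : extension z B = C by [].
  apply: extensionE; split=> // y Py.
  have [_ _ _ hadj _] := semigroup_endo alphaE Py.
  have [_ _ _ hadj' _] := semigroup_endo alphaE (Py' _ Py).
  have := hadj _ _ MA' MC AC; rewrite extension_semigroup// => h.
  have h' := hadj' _ _ MA MB AB.
  apply/funext => x; apply: (rdot_inj (dot := dot)) => w.
  by rewrite rdotC -(rdot_adjoint _ _ h) (rdot_adjoint _ _ h') rdotC.
- exact: extension_predual.
Qed.

(** A three-epsilon argument: the orbit approximation is uniform in x by contractivity, and for a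
    fixed orbit functional y + t is interior, where [alpha] is continuous. *)
Lemma extension_continuous : sigma_weakly_continuous dot M P extension.
Proof.
move=> rho A rhoM MA; apply/subspace_continuousP => t Pt; rewrite /from_subspace.
suff main B : M B -> operator_unit_ball B ->
    rho (extension x B) @[x --> within P (nbhs t)] --> rho (extension t B).
  have [K K0 [B1 AE]] := vn_unit_ball_scale MvN MA.
  set B := _ *: A in B1 AE; have MB : M B by exact: (vn_scale MvN).
  clearbody B.
  have rhoE x : P x -> rho (extension x A) = K%:C * rho (extension x B).
    by move=> Px; rewrite AE extensionZ// (predualZ MvN)//; exact: extension_mem.
  rewrite rhoE//.
  apply: cvg_trans (cvgM (cvg_cst (K%:C : R[i]^o)) (main B MB B1)).
  have Pnear : \forall x \near within P (nbhs t), P x by exact: withinT.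
  apply: near_eq_cvg; apply: filterS Pnear => x Px; exact/esym/rhoE.
move=> MB B1; apply/cvgrPdist_le => _ /gtc0P[e e0 ->].
have e3 : 0 < e / 3 by rewrite divr_gt0.
have [L LE] := orbit_functionals_dense Hhilbert MvN alphaE alpha_faithful rhoM e3.
have L_cvg : (\sum_(p <- L) dot (alpha (sval p.1 + x) B p.2.1) p.2.2 : R[i]^o)
    @[x --> within P (nbhs t)] -->
    (\sum_(p <- L) dot (alpha (sval p.1 + t) B p.2.1) p.2.2 : R[i]^o).
  elim: L {LE} => [|p L IH].
    by rewrite big_nil; apply: cvg_near_cst; apply: nearW => x; rewrite big_nil.
  rewrite big_cons; under eq_fun do rewrite big_cons.
  apply: cvgD IH; have Py := svalP p.1; set y := sval p.1 in Py *.
  apply: (semigroup_cvg alpha_cont (predual_vector dot M p.2.1 p.2.2) MB).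
    exact: interior_coneD.
  apply: cvgD; first exact: cvg_cst.
  exact: cvg_within.
have e3' : 0 < (e / 3)%:C by rewrite ltcR.
have /cvgrPdist_le/(_ _ e3') := L_cvg.
have Pnear : \forall x \near within P (nbhs t), P x by exact: withinT.
apply: filterS2 Pnear => x Px; rewrite -!extension_orbit_list// => h.
have hx := LE _ (extension_mem Px MB) (extension_unit_ball Px MB B1).
have ht := LE _ (extension_mem Pt MB) (extension_unit_ball Pt MB B1).
rewrite -(subrKA (orbit_list dot alpha L (extension t B))).
rewrite -[X in _ + X](subrKA (orbit_list dot alpha L (extension x B))).
rewrite (_ : e = e / 3 + (e / 3 + e / 3)); last by field.
rewrite !rmorphD (le_trans (ler_normD _ _))// lerD//.
by rewrite (le_trans (ler_normD _ _))// lerD// distrC.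
Qed.

Lemma extension_E0 : unital P° alpha -> E0_semigroup dot M P extension.
Proof.
move=> alpha1; split=> [|x Px|A MA|]; last exact: extension_continuous.
- split=> [x|x y A Px Py MA]; first exact: extension_endomorphism.
  have MB := extension_mem Py MA.
  apply/esym/extensionE; split=> [|z Pz]; first exact: extension_mem.
  rewrite extension_semigroup// extension_semigroup ?addrA//.
  exact: interior_coneD.
- apply: extensionE; split=> [|y Py]; first exact: (vn_id MvN).
  by rewrite !alpha1//; exact: interior_coneD.
- by apply: extensionE; split=> // y Py; rewrite addr0.
Qed.

(** The semigroup law of [beta] on [P] gives [alpha y (beta z A) = alpha (y + z) A] for interior y,
    the property that characterises the extension. *)
Lemma extension_unique beta : E0_semigroup dot M P beta ->
  same_family M P° beta alpha -> same_family M P beta extension.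
Proof.
move=> [[beta_endo betaD] _ _ _] beta_alpha z A Pz MA; apply/esym/extensionE.
have [betaM _ _ _ _] := beta_endo z Pz; split=> [|y Py]; first exact: betaM.
rewrite -!beta_alpha//; [|exact: interior_coneD|exact: betaM].
by apply: betaD => //; exact: interior_subset.
Qed.

End ExtendedSemigroup.

Theorem proposition4p2 (R : realType) (n : nat) (P : set 'rV[R]_n)
    (Pcone : closed_convex_cone P) (Pspan : spanning P) (Ppointed : pointed P)
    (H : completeNormedModType R[i]) (dot : {dot H for @conjc R})
    (Hhilbert : hilbert_norm dot)
    (M : set (H -> H)) (MvN : von_neumann_algebra dot M)
    (Msep : separable_predual dot M)
    (alpha : 'rV[R]_n -> (H -> H) -> (H -> H))
    (alphaE : E_semigroup dot M P° alpha)
    (alpha_meas : sigma_weakly_measurable dot M P° alpha)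
    (alpha_faithful : faithful M P° alpha) :
  (E_semigroup dot M P° alpha /\ sigma_weakly_continuous dot M P° alpha) /\
  (unital P° alpha ->
     exists alpha' : 'rV[R]_n -> (H -> H) -> (H -> H),
       [/\ E0_semigroup dot M P alpha',
           same_family M P° alpha' alpha &
           forall beta : 'rV[R]_n -> (H -> H) -> (H -> H),
             E0_semigroup dot M P beta ->
             same_family M P° beta alpha ->
             same_family M P beta alpha']).
Proof.
have alpha_cont : sigma_weakly_continuous dot M P° alpha.
  exact: (semigroup_continuous Hhilbert MvN Pcone alphaE Msep alpha_meas).
split=> // alpha1; exists (extension M P alpha); split.
- exact: extension_E0.
- move=> x A Px MA; exact: (extension_interior MvN alphaE alpha_faithful).
- move=> beta betaE0; exact: (extension_unique MvN Pcone alphaE alpha_faithful).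
Qed.
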